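(* Let $H$ be a Hopf algebra over a field $k$, let $s\colon H\otimes H\to H\otimes H$ be a left non-degenerate set-theoretic type solution of the braid equation, let $s_1:=(H\otimes\epsilon)\circ s$, $s_2:=(\epsilon\otimes H)\circ s$, and let $\cdot$ and $\mathbin{:}$ be the binary operations on $H$ associated with $s$. The following assertions are equivalent: (1) $(H,s)$ is a weak braiding operator. (2) $(H,s_2,s_1)$ is a matched pair. (3) $(H,\cdot,\mathbin{:})$ is a Hopf $q$-brace.
   Context: All vector spaces, maps and tensor products are over $k$ (maps are linear); Sweedler notation is used; $\mu,\eta,\epsilon$ are the multiplication, unit and counit of $H$; $H$ inside a tensor product of maps denotes $\mathrm{id}_H$; $H^{\mathrm{cop}}$, $H^{\mathrm{op}}$ denote opposite coalgebra/algebra. A set-theoretic type solution of the braid equation on $H$ is a coalgebra endomorphism $s$ of $H\otimes H$ with $(s\otimes H)(H\otimes s)(s\otimes H)=(H\otimes s)(s\otimes H)(H\otimes s)$. Write ${}^hl:=s_1(h\otimes l)$, $h^l:=s_2(h\otimes l)$ and $G_s(h\otimes l):=h^{l_{(1)}}\otimes l_{(2)}$; $s$ is left non-degenerate if $G_s$ is invertible. Then the associated operations are $h\cdot l:=(H\otimes\epsilon)G_s^{-1}(h\otimes l)$ and $h\mathbin{:}l:={}^{l\cdot h_{(1)}}h_{(2)}$. $(H,s)$ is a weak braiding operator if $s$ is a set-theoretic type solution of the braid equation and $s(\mu\otimes H)=(H\otimes\mu)(s\otimes H)(H\otimes s)$, $s(H\otimes\mu)=(\mu\otimes H)(H\otimes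 s)(s\otimes H)$, $s(\eta\otimes H)=H\otimes\eta$, $s(H\otimes\eta)=\eta\otimes H$. $(H,s_2,s_1)$ is a matched pair if: (i) $H$ is a right $H$-module coalgebra via $h\otimes l\mapsto h^l$; (ii) $H$ is a left $H$-module coalgebra via $h\otimes l\mapsto{}^hl$; (iii) ${}^l(hh')=({}^{l_{(1)}}h_{(1)})({}^{{l_{(2)}}^{h_{(2)}}}h')$; (iv) $(l'l)^h=({l'}^{{}^{l_{(1)}}h_{(1)}})({l_{(2)}}^{h_{(2)}})$; (v) $1^h=\epsilon(h)1$ and ${}^l1=\epsilon(l)1$; (vi) ${}^{l_{(1)}}h_{(1)}\otimes{l_{(2)}}^{h_{(2)}}={}^{l_{(2)}}h_{(2)}\otimes{l_{(1)}}^{h_{(1)}}$, for all $h,h',l,l'\in H$. A triple $(H,\cdot,\mathbin{:})$ with linear maps $\cdot,\mathbin{:}\colon H\otimes H\to H$ satisfying $\epsilon(x\cdot y)=\epsilon(x\mathbin{:}y)=\epsilon(x)\epsilon(y)$ is a $q$-magma coalgebra if $H\otimes H^{\mathrm{cop}}\to H^{\mathrm{cop}}\otimes H$, $x\otimes y\mapsto y_{(1)}\mathbin{:}x_{(2)}\otimes x_{(1)}\cdot y_{(2)}$, is a coalgebra morphism; left regular if $x\otimes y\mapsto x\cdot y_{(1)}\otimes y_{(2)}$ is invertible; a $q$-cycle coalgebra if it is left regular and for all $x,y,z$: $(x\cdot y_{(1)})\cdot(z\mathbin{:}y_{(2)})=(x\cdot z_{(2)})\cdot(y\cdot z_{(1)})$,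 $(x\cdot y_{(1)})\mathbin{:}(z\cdot y_{(2)})=(x\mathbin{:}z_{(2)})\cdot(y\mathbin{:}z_{(1)})$, $(x\mathbin{:}y_{(1)})\mathbin{:}(z\mathbin{:}y_{(2)})=(x\mathbin{:}z_{(2)})\mathbin{:}(y\cdot z_{(1)})$. It is a Hopf $q$-brace if it is a $q$-cycle coalgebra, $H$ is a right $H^{\mathrm{op}}$-module via $\cdot$ and via $\mathbin{:}$ (that is, $h\cdot1=h$, $h\cdot kl=(h\cdot l)\cdot k$ and likewise for $\mathbin{:}$), and $hk\cdot l=(h\cdot(l_{(1)}\mathbin{:}k_{(2)}))(k_{(1)}\cdot l_{(2)})$ and $hk\mathbin{:}l=(h\mathbin{:}(l_{(1)}\cdot k_{(2)}))(k_{(1)}\mathbin{:}l_{(2)})$ for all $h,k,l\in H$. (Multiplication in $H$ binds tighter than $\cdot$ and $\mathbin{:}$.) *)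

(* Defs.v *)
From HB Require Import structures.
From mathcomp Require Import all_boot all_order all_algebra.
From mathcomp Require Import boolp.

Set Implicit Arguments.
Unset Strict Implicit.
Unset Printing Implicit Defensive.

Import GRing.Theory.
Local Open Scope ring_scope.
Local Open Scope quotient_scope.

Reserved Notation "x ⊗ y" (at level 46, left associativity).
Reserved Notation "x · y" (at level 43, no associativity).
Reserved Notation "x ∶ y" (at level 43, no associativity).
Reserved Notation "x ◁ y" (at level 43, no associativity).
Reserved Notation "x ▷ y" (at level 43, no associativity).
Reserved Notation "\sw_ ( x1 , x2 <- x ) E"
  (at level 47, x1 name, x2 name, x at level 46, E at level 47,
   format "\sw_ ( x1 ,  x2  <-  x )  E").

Definition bilinear_fun (k : fieldType) (U V W : lmodType k)
    (f : U -> V -> W) : Prop :=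
  (forall v, linear (f^~ v)) /\ (forall u, linear (f u)).

Section Tensor.
Variables (k : fieldType) (U V : lmodType k).
Implicit Types (s t : seq (U * V)) (u : U) (v : V).

Inductive tensor_eq : seq (U * V) -> seq (U * V) -> Prop :=
| tensor_eq_refl s : tensor_eq s s
| tensor_eq_sym s t : tensor_eq s t -> tensor_eq t s
| tensor_eq_trans s t r : tensor_eq s t -> tensor_eq t r -> tensor_eq s r
| tensor_eq_cat s t s' t' :
    tensor_eq s t -> tensor_eq s' t' -> tensor_eq (s ++ s') (t ++ t')
| tensor_eq_catC s t : tensor_eq (s ++ t) (t ++ s)
| tensor_eq_addl u u' v : tensor_eq [:: (u + u', v)] [:: (u, v); (u', v)]
| tensor_eq_addr u v v' : tensor_eq [:: (u, v + v')] [:: (u, v); (u, v')]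
| tensor_eq_scale (a : k) u v : tensor_eq [:: (a *: u, v)] [:: (u, a *: v)]
| tensor_eq_0l v : tensor_eq [:: (0, v)] [::].

Definition tensor_eqb s t : bool := `[< tensor_eq s t >].

Fact tensor_eqb_refl : reflexive tensor_eqb.
Proof. by move=> s; apply/asboolP; exact: tensor_eq_refl. Qed.

Fact tensor_eqb_sym : symmetric tensor_eqb.
Proof. by move=> s t; apply/asboolP/asboolP; apply: tensor_eq_sym. Qed.

Fact tensor_eqb_trans : transitive tensor_eqb.
Proof.
move=> t s r /asboolP st /asboolP tr; apply/asboolP.
exact: tensor_eq_trans st tr.
Qed.

Canonical tensor_equiv :=
  EquivRel tensor_eqb tensor_eqb_refl tensor_eqb_sym tensor_eqb_trans.

(** [tensor U V], written U ⊗ V, is the commutative monoid of finite formal sums of pairs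
    (u, v), quotiented by the congruence generated by the bilinearity
    relations. It is an abelian group since -(u, v) is the class of (-u, v). *)
Definition tensor_sort : Type := {eq_quot tensor_equiv}.

HB.instance Definition _ := Choice.on tensor_sort.
HB.instance Definition _ := EqQuotient.on tensor_sort.

Lemma tensor_piP s t : tensor_eq s t -> \pi_tensor_sort s = \pi_tensor_sort t.
Proof. by move=> st; apply/eqmodP/asboolP. Qed.

Lemma tensor_repr s : tensor_eq (repr (\pi_tensor_sort s)) s.
Proof.
by apply/asboolP; rewrite -/(tensor_eqb _ _) -(eqmodE tensor_equiv) reprK.
Qed.

Definition tensor_zero : tensor_sort := \pi_tensor_sort [::].
Definition tensor_add (x y : tensor_sort) : tensor_sort := \pi_tensor_sort (repr x ++ repr y).
Definition tensor_scale (a : k) (x : tensor_sort) : tensor_sort :=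
  \pi_tensor_sort [seq (a *: p.1, p.2) | p <- repr x].
Definition tensor_opp (x : tensor_sort) : tensor_sort := tensor_scale (-1) x.

Lemma tensor_addE s t :
  tensor_add (\pi_tensor_sort s) (\pi_tensor_sort t) = \pi_tensor_sort (s ++ t).
Proof. by apply: tensor_piP; apply: tensor_eq_cat; apply: tensor_repr. Qed.

Lemma tensor_eq_map a s t : tensor_eq s t ->
  tensor_eq [seq (a *: p.1, p.2) | p <- s] [seq (a *: p.1, p.2) | p <- t].
Proof.
elim=> {s t}.
- by move=> s; apply: tensor_eq_refl.
- by move=> s t _; apply: tensor_eq_sym.
- by move=> s t r _ st _; apply: tensor_eq_trans.
- by move=> s t s' t' _ h _ h'; rewrite !map_cat; apply: tensor_eq_cat.
- by move=> s t; rewrite !map_cat; apply: tensor_eq_catC.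
- by move=> u u' v /=; rewrite scalerDr; apply: tensor_eq_addl.
- by move=> u v v' /=; apply: tensor_eq_addr.
- by move=> b u v /=; rewrite scalerA mulrC -scalerA; apply: tensor_eq_scale.
- by move=> v /=; rewrite scaler0; apply: tensor_eq_0l.
Qed.

Lemma tensor_scaleE a s :
  tensor_scale a (\pi_tensor_sort s) = \pi_tensor_sort [seq (a *: p.1, p.2) | p <- s].
Proof. by apply: tensor_piP; apply: tensor_eq_map; apply: tensor_repr. Qed.

Fact tensor_addA : associative tensor_add.
Proof.
elim/quotW=> s; elim/quotW=> t; elim/quotW=> r.
by rewrite (tensor_addE t r) (tensor_addE s t) 2!tensor_addE catA.
Qed.

Fact tensor_addC : commutative tensor_add.
Proof.
elim/quotW=> s; elim/quotW=> t; rewrite !tensor_addE.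
by apply: tensor_piP; apply: tensor_eq_catC.
Qed.

Fact tensor_add0 : left_id tensor_zero tensor_add.
Proof. by elim/quotW=> s; rewrite tensor_addE. Qed.

Lemma tensor_scaleDs a b s :
  tensor_eq [seq ((a + b) *: p.1, p.2) | p <- s]
    ([seq (a *: p.1, p.2) | p <- s] ++ [seq (b *: p.1, p.2) | p <- s]).
Proof.
elim: s => [|[u v] s IH] /=; first exact: tensor_eq_refl.
rewrite scalerDl.
apply: tensor_eq_trans (tensor_eq_cat (tensor_eq_addl _ _ _) IH) _.
apply: (tensor_eq_cat (tensor_eq_refl [:: (a *: u, v)])).
set A := [seq (a *: p.1, p.2) | p <- s]; set B := [seq _ | p <- s].
rewrite -(cat1s (b *: u, v) B) catA.
exact: (tensor_eq_cat (tensor_eq_catC [:: _] A) (tensor_eq_refl B)).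
Qed.

Fact tensor_scaleDl x : {morph tensor_scale^~ x : a b / a + b >-> tensor_add a b}.
Proof.
move=> a b; elim/quotW: x => s; rewrite !tensor_scaleE tensor_addE.
by apply: tensor_piP; apply: tensor_scaleDs.
Qed.

Fact tensor_scale1 : left_id 1 tensor_scale.
Proof.
elim/quotW=> s; rewrite tensor_scaleE; congr (\pi_tensor_sort _).
by rewrite -[RHS]map_id; apply: eq_map => -[u v] /=; rewrite scale1r.
Qed.

Fact tensor_scale0 x : tensor_scale 0 x = tensor_zero.
Proof.
elim/quotW: x => s; rewrite tensor_scaleE; apply: tensor_piP.
elim: s => [|[u v] s IH] /=; first exact: tensor_eq_refl.
by rewrite -cat1s scale0r -[[::]]cats0; apply: tensor_eq_cat; first exact: tensor_eq_0l.
Qed.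

Fact tensor_addN : left_inverse tensor_zero tensor_opp tensor_add.
Proof.
move=> x; rewrite -{2}[x]tensor_scale1 -tensor_scaleDl addNr.
exact: tensor_scale0.
Qed.

HB.instance Definition _ := GRing.isZmodule.Build tensor_sort
  tensor_addA tensor_addC tensor_add0 tensor_addN.

Fact tensor_scaleA a b x :
  tensor_scale a (tensor_scale b x) = tensor_scale (a * b) x.
Proof.
elim/quotW: x => s.
rewrite (tensor_scaleE b s) 2!tensor_scaleE -map_comp; congr (\pi_tensor_sort _).
by apply: eq_map => -[u v] /=; rewrite scalerA.
Qed.

Fact tensor_scaleDr : right_distributive tensor_scale +%R.
Proof.
move=> a; elim/quotW=> s; elim/quotW=> t.
by rewrite [_ + _](tensor_addE s t) !tensor_scaleE map_cat [RHS]tensor_addE.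
Qed.

HB.instance Definition _ := GRing.Zmodule_isLmodule.Build k tensor_sort
  tensor_scaleA tensor_scale1 tensor_scaleDr tensor_scaleDl.

Definition tensor : lmodType k := GRing.Lmodule.clone k tensor_sort _.

Definition tens u v : tensor := \pi_tensor_sort [:: (u, v)].

Fact tens_linearl v : linear (tens^~ v).
Proof.
move=> a u u'; rewrite [a *: tens _ _]tensor_scaleE [RHS]tensor_addE.
by apply: tensor_piP; apply: tensor_eq_addl.
Qed.

Fact tens_linearr u : linear (tens u).
Proof.
move=> a v v'; rewrite [a *: tens _ _]tensor_scaleE [RHS]tensor_addE.
apply: tensor_piP; apply: tensor_eq_trans (tensor_eq_addr _ _ _) _.
rewrite -cat1s; apply: (tensor_eq_cat (s' := [:: _])); last exact: tensor_eq_refl.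
by apply: tensor_eq_sym; apply: tensor_eq_scale.
Qed.

Lemma tens_bilinear : bilinear_fun tens.
Proof. by split; [apply: tens_linearl|apply: tens_linearr]. Qed.

Lemma tens_linearZl a u v : tens (a *: u) v = a *: tens u v.
Proof. by rewrite [RHS]tensor_scaleE. Qed.

HB.instance Definition _ u :=
  GRing.isLinear.Build k V tensor _ (tens u) (tens_linearr u).

Lemma tensor_sumE (x : tensor) : x = \sum_(p <- repr x) tens p.1 p.2.
Proof.
rewrite -{1}[x]reprK; elim: (repr x) => [|[u v] s IH]; first by rewrite big_nil.
by rewrite big_cons -IH [RHS]tensor_addE.
Qed.

End Tensor.

Notation "U ⊗ V" := (tensor U%type V%type) : type_scope.
Notation "u ⊗ v" := (tens u v) : ring_scope.

(** The linear map U ⊗ V -> W induced by a bilinear map f, see [tlift_tens].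
    It is defined on a representative, hence meaningful for bilinear f only. *)
Definition tlift (k : fieldType) (U V W : lmodType k) (f : U -> V -> W)
  (x : U ⊗ V) : W := \sum_(p <- repr x) f p.1 p.2.

Section TensorLift.
Variables (k : fieldType) (U V W : lmodType k).

Lemma linear_funD (A B : lmodType k) (f : A -> B) :
  linear f -> {morph f : x y / x + y}.
Proof. by move=> lf x y; have := lf 1 x y; rewrite !scale1r. Qed.

Lemma linear_fun0 (A B : lmodType k) (f : A -> B) : linear f -> f 0 = 0.
Proof. by move=> lf; have := lf (-1) 0 0; rewrite !scaleN1r !addNr. Qed.

Lemma linear_funZ (A B : lmodType k) (f : A -> B) a x :
  linear f -> f (a *: x) = a *: f x.
Proof.
by move=> lf; have := lf a x 0; rewrite !addr0 (linear_fun0 lf) addr0.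
Qed.

Lemma tensor_eq_lift (f : U -> V -> W) s t :
  bilinear_fun f -> tensor_eq s t ->
  \sum_(p <- s) f p.1 p.2 = \sum_(p <- t) f p.1 p.2.
Proof.
move=> [fl fr]; elim=> {s t} //.
- by move=> s t r _ -> _ ->.
- by move=> s t s' t' _ e _ e'; rewrite !big_cat /= e e'.
- by move=> s t; rewrite !big_cat /= addrC.
- by move=> u u' v; rewrite !big_cons !big_nil !addr0 /= (linear_funD (fl v)).
- by move=> u v v'; rewrite !big_cons !big_nil !addr0 /= (linear_funD (fr u)).
- move=> a u v; rewrite !big_cons !big_nil !addr0 /=.
  by rewrite (linear_funZ _ _ (fl v)) (linear_funZ _ _ (fr u)).
- by move=> v; rewrite !big_cons !big_nil !addr0 /= (linear_fun0 (fl v)).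
Qed.

Lemma tlift_tens (f : U -> V -> W) u v :
  bilinear_fun f -> tlift f (u ⊗ v) = f u v.
Proof.
move=> bf; rewrite /tlift (tensor_eq_lift bf (tensor_repr _)).
by rewrite big_cons big_nil addr0.
Qed.

Lemma tlift_linear (f : U -> V -> W) : bilinear_fun f -> linear (tlift f).
Proof.
move=> bf a x y; rewrite /tlift.
have -> : a *: x + y =
    \pi_(tensor_sort U V) ([seq (a *: p.1, p.2) | p <- repr x] ++ repr y).
  by rewrite -[in LHS](reprK y) [LHS]tensor_addE.
rewrite (tensor_eq_lift bf (tensor_repr _)) big_cat big_map /= scaler_sumr.
by congr (_ + _); apply: eq_bigr => p _; rewrite (linear_funZ _ _ (bf.1 _)).
Qed.

Lemma tlift_combE a (f g : U -> V -> W) x :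
  tlift (fun u v => a *: f u v + g u v) x = a *: tlift f x + tlift g x.
Proof. by rewrite /tlift big_split /= scaler_sumr. Qed.

Lemma eq_tlift (f g : U -> V -> W) x :
  (forall u v, f u v = g u v) -> tlift f x = tlift g x.
Proof. by move=> fg; apply: eq_bigr => p _; apply: fg. Qed.

Lemma tensor_ext (f g : U ⊗ V -> W) : linear f -> linear g ->
  (forall u v, f (u ⊗ v) = g (u ⊗ v)) -> f =1 g.
Proof.
move=> lf lg fg x; rewrite (tensor_sumE x).
elim: (repr x) => [|p s IH].
  by rewrite !big_nil (linear_fun0 lf) (linear_fun0 lg).
by rewrite !big_cons (linear_funD lf) (linear_funD lg) IH fg.
Qed.

End TensorLift.

Section TensorMaps.
Variable k : fieldType.
Implicit Types A B C D U V W : lmodType k.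

Definition tmap U V U' V' (f : U -> U') (g : V -> V') : U ⊗ V -> U' ⊗ V' :=
  tlift (fun u v => f u ⊗ g v).

Definition tassoc U V W : (U ⊗ V) ⊗ W -> U ⊗ (V ⊗ W) :=
  tlift (fun x w => tlift (fun u v => u ⊗ (v ⊗ w)) x).

Definition tassocI U V W : U ⊗ (V ⊗ W) -> (U ⊗ V) ⊗ W :=
  tlift (fun u y => tlift (fun v w => (u ⊗ v) ⊗ w) y).

Definition tswap U V : U ⊗ V -> V ⊗ U := tlift (fun u v => v ⊗ u).

Definition tmid A B C D : (A ⊗ B) ⊗ (C ⊗ D) -> (A ⊗ C) ⊗ (B ⊗ D) :=
  tlift (fun x y =>
    tlift (fun a b => tlift (fun c d => (a ⊗ c) ⊗ (b ⊗ d)) y) x).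

Lemma bilinear_tmap U V U' V' (f : {linear U -> U'}) (g : {linear V -> V'}) :
  bilinear_fun (fun u v => f u ⊗ g v).
Proof.
by split=> [v a x y|u a x y]; rewrite linearP ?tens_linearl ?linearP.
Qed.

Fact tmap_linear U V U' V' (f : {linear U -> U'}) (g : {linear V -> V'}) :
  linear (tmap f g).
Proof. exact: tlift_linear (bilinear_tmap f g). Qed.
HB.instance Definition _ U V U' V' (f : {linear U -> U'}) (g : {linear V -> V'}) :=
  GRing.isLinear.Build k (U ⊗ V)%type (U' ⊗ V')%type _ (tmap f g)
    (tmap_linear f g).

Lemma tmapE U V U' V' (f : {linear U -> U'}) (g : {linear V -> V'}) u v :
  tmap f g (u ⊗ v) = f u ⊗ g v.
Proof. exact: tlift_tens (bilinear_tmap f g). Qed.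

Lemma bilinear_tassoc2 U V W (w : W) :
  bilinear_fun (fun (u : U) (v : V) => u ⊗ (v ⊗ w)).
Proof.
by split=> [v a x y|u a x y]; rewrite ?tens_linearl ?linearP.
Qed.

Lemma bilinear_tassoc U V W : bilinear_fun
  (fun x (w : W) => tlift (fun (u : U) (v : V) => u ⊗ (v ⊗ w)) x).
Proof.
split=> [w|x a w w']; first exact: tlift_linear (bilinear_tassoc2 U V w).
by rewrite -tlift_combE; apply: eq_tlift => u v; rewrite !linearP.
Qed.

Fact tassoc_linear U V W : linear (@tassoc U V W).
Proof. exact: tlift_linear (bilinear_tassoc _ _ _). Qed.
HB.instance Definition _ U V W :=
  GRing.isLinear.Build k ((U ⊗ V) ⊗ W)%type (U ⊗ (V ⊗ W))%type _
    (@tassoc U V W) (@tassoc_linear U V W).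

Lemma tassocE U V W (u : U) (v : V) (w : W) :
  tassoc ((u ⊗ v) ⊗ w) = u ⊗ (v ⊗ w).
Proof.
rewrite /tassoc tlift_tens; last exact: bilinear_tassoc.
by rewrite tlift_tens //; exact: bilinear_tassoc2.
Qed.

Lemma bilinear_tassocI2 U V W (u : U) :
  bilinear_fun (fun (v : V) (w : W) => (u ⊗ v) ⊗ w).
Proof.
by split=> [v a x y|v a x y]; rewrite ?linearP ?tens_linearl.
Qed.

Lemma bilinear_tassocI U V W : bilinear_fun
  (fun (u : U) y => tlift (fun (v : V) (w : W) => (u ⊗ v) ⊗ w) y).
Proof.
split=> [y a u u'|u]; last exact: tlift_linear (bilinear_tassocI2 V W u).
by rewrite -tlift_combE; apply: eq_tlift => v w; rewrite !tens_linearl.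
Qed.

Fact tassocI_linear U V W : linear (@tassocI U V W).
Proof. exact: tlift_linear (bilinear_tassocI _ _ _). Qed.
HB.instance Definition _ U V W :=
  GRing.isLinear.Build k (U ⊗ (V ⊗ W))%type ((U ⊗ V) ⊗ W)%type _
    (@tassocI U V W) (@tassocI_linear U V W).

Lemma tassocIE U V W (u : U) (v : V) (w : W) :
  tassocI (u ⊗ (v ⊗ w)) = (u ⊗ v) ⊗ w.
Proof.
rewrite /tassocI tlift_tens; last exact: bilinear_tassocI.
by rewrite tlift_tens //; exact: bilinear_tassocI2.
Qed.

Lemma bilinear_tswap U V : bilinear_fun (fun (u : U) (v : V) => v ⊗ u).
Proof. by split=> [v|u]; [exact: tens_linearr|exact: tens_linearl]. Qed.

Fact tswap_linear U V : linear (@tswap U V).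
Proof. exact: tlift_linear (bilinear_tswap _ _). Qed.
HB.instance Definition _ U V :=
  GRing.isLinear.Build k (U ⊗ V)%type (V ⊗ U)%type _
    (@tswap U V) (@tswap_linear U V).

Lemma tswapE U V (u : U) (v : V) : tswap (u ⊗ v) = v ⊗ u.
Proof. exact: tlift_tens (bilinear_tswap _ _). Qed.

Lemma bilinear_tmid1 A B C D (a : A) (b : B) :
  bilinear_fun (fun (c : C) (d : D) => (a ⊗ c) ⊗ (b ⊗ d)).
Proof.
by split=> [v r x y|v r x y]; rewrite !linearP ?tens_linearl.
Qed.

Lemma bilinear_tmid2 A B C D (y : C ⊗ D) : bilinear_fun
  (fun (a : A) (b : B) => tlift (fun c d => (a ⊗ c) ⊗ (b ⊗ d)) y).
Proof.
by split=> [v r x x'|v r x x']; rewrite -tlift_combE; apply: eq_tlift => c d;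
  rewrite !tens_linearl ?linearP.
Qed.

Lemma bilinear_tmid A B C D : bilinear_fun (fun (x : A ⊗ B) (y : C ⊗ D) =>
  tlift (fun a b => tlift (fun c d => (a ⊗ c) ⊗ (b ⊗ d)) y) x).
Proof.
split=> [y|x r y y']; first exact: tlift_linear (bilinear_tmid2 A B y).
rewrite -tlift_combE; apply: eq_tlift => a b.
exact: tlift_linear (bilinear_tmid1 C D a b) r y y'.
Qed.

Fact tmid_linear A B C D : linear (@tmid A B C D).
Proof. exact: tlift_linear (bilinear_tmid _ _ _ _). Qed.
HB.instance Definition _ A B C D :=
  GRing.isLinear.Build k ((A ⊗ B) ⊗ (C ⊗ D))%type ((A ⊗ C) ⊗ (B ⊗ D))%type _
    (@tmid A B C D) (@tmid_linear A B C D).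

Lemma tmidE A B C D (a : A) (b : B) (c : C) (d : D) :
  tmid ((a ⊗ b) ⊗ (c ⊗ d)) = (a ⊗ c) ⊗ (b ⊗ d).
Proof.
rewrite /tmid tlift_tens; last exact: bilinear_tmid.
rewrite tlift_tens; last exact: bilinear_tmid2.
by rewrite tlift_tens //; exact: bilinear_tmid1.
Qed.

(** The maps f ⊗ V and U ⊗ g for linear forms f and g, with k ⊗ V and U ⊗ k
    identified with V and U. *)
Definition tforml U V (f : U -> k) : U ⊗ V -> V :=
  tlift (fun u v => f u *: v).
Definition tformr U V (g : V -> k) : U ⊗ V -> U :=
  tlift (fun u v => g v *: u).

Lemma bilinear_tforml U V (f : {scalar U}) :
  bilinear_fun (fun u (v : V) => f u *: v).
Proof.
split=> [v a x y|u a x y]; first by rewrite linearP scalerDl scalerA.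
by rewrite scalerDr !scalerA mulrC.
Qed.

Lemma bilinear_tformr U V (g : {scalar V}) :
  bilinear_fun (fun (u : U) v => g v *: u).
Proof. by have [h h'] := bilinear_tforml U g; split. Qed.

Fact tforml_linear U V (f : {scalar U}) : linear (@tforml U V f).
Proof. exact: tlift_linear (bilinear_tforml V f). Qed.
HB.instance Definition _ U V (f : {scalar U}) :=
  GRing.isLinear.Build k (U ⊗ V)%type V _ (@tforml U V f)
    (@tforml_linear U V f).

Fact tformr_linear U V (g : {scalar V}) : linear (@tformr U V g).
Proof. exact: tlift_linear (bilinear_tformr U g). Qed.
HB.instance Definition _ U V (g : {scalar V}) :=
  GRing.isLinear.Build k (U ⊗ V)%type U _ (@tformr U V g)
    (@tformr_linear U V g).

Lemma tformlE U V (f : {scalar U}) u (v : V) :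
  tforml f (u ⊗ v) = f u *: v.
Proof. exact: tlift_tens (bilinear_tforml V f). Qed.

Lemma tformrE U V (g : {scalar V}) (u : U) v :
  tformr g (u ⊗ v) = g v *: u.
Proof. exact: tlift_tens (bilinear_tformr U g). Qed.

Lemma tensor_ext4 A B C D W (f g : {linear ((A ⊗ B) ⊗ (C ⊗ D))%type -> W}) :
  (forall a b c d, f ((a ⊗ b) ⊗ (c ⊗ d)) = g ((a ⊗ b) ⊗ (c ⊗ d))) -> f =1 g.
Proof.
move=> fg; apply: tensor_ext => [||x y]; [exact: linearP|exact: linearP|].
apply: (tensor_ext (f := fun x => f (x ⊗ y)) (g := fun x => g (x ⊗ y))).
- by move=> r u v; rewrite tens_linearl linearP.
- by move=> r u v; rewrite tens_linearl linearP.
move=> a b.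
apply: (tensor_ext (f := fun y => f (a ⊗ b ⊗ y)) (g := fun y => g (a ⊗ b ⊗ y))).
- by move=> r u v; rewrite !linearP.
- by move=> r u v; rewrite !linearP.
exact: fg.
Qed.

End TensorMaps.

Arguments tassoc {k U V W}.
Arguments tassocI {k U V W}.
Arguments tswap {k U V}.
Arguments tmid {k A B C D}.

HB.mixin Record Lmodule_isCoalgebra (k : fieldType) C of GRing.Lmodule k C := {
  comul_subdef : {linear C -> (C ⊗ C)%type};
  counit_subdef : {scalar C};
  comulA_subproof : forall c : C,
    tassoc (tmap comul_subdef idfun (comul_subdef c)) =
    tmap idfun comul_subdef (comul_subdef c);
  comul_counitl_subproof : forall c : C,
    tforml counit_subdef (comul_subdef c) = c;
  comul_counitr_subproof : forall c : C,
    tformr counit_subdef (comul_subdef c) = c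
}.

#[short(type="coalgType")]
HB.structure Definition Coalgebra (k : fieldType) :=
  {C of GRing.Lmodule k C & Lmodule_isCoalgebra k C}.

Section CoalgebraTheory.
Variables (k : fieldType) (C : coalgType k).

Definition comul : {linear C -> (C ⊗ C)%type} := comul_subdef.
Definition counit : {scalar C} := counit_subdef.

Lemma comulA (c : C) :
  tassoc (tmap comul idfun (comul c)) = tmap idfun comul (comul c).
Proof. exact: comulA_subproof. Qed.

Lemma comul_counitl (c : C) : tforml counit (comul c) = c.
Proof. exact: comul_counitl_subproof. Qed.

Lemma comul_counitr (c : C) : tformr counit (comul c) = c.
Proof. exact: comul_counitr_subproof. Qed.

End CoalgebraTheory.

Arguments comul {k C}.
Arguments counit {k C}.

(** Sweedler notation: [\sw_(x1, x2 <- x) E] is the sum of the E(x1, x2) over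
    the tensors x1 ⊗ x2 of the comultiplication of x; E must be bilinear. *)
Definition sweedler (k : fieldType) (C : coalgType k) (W : lmodType k)
  (x : C) (E : C -> C -> W) : W := tlift E (comul x).

Notation "\sw_ ( x1 , x2 <- x ) E" := (sweedler x (fun x1 x2 => E)) : ring_scope.

Definition coalg_morphism (k : fieldType) (C D : coalgType k) (f : C -> D) :
    Prop :=
  [/\ linear f,
      forall c, comul (f c) = tmap f f (comul c)
    & forall c, counit (f c) = counit c].

Section TensorCoalgebra.
Variables (k : fieldType) (C D : coalgType k).

Definition tensor_comul : C ⊗ D -> (C ⊗ D) ⊗ (C ⊗ D) :=
  @tmid k C C D D \o tmap comul comul.

HB.instance Definition _ := GRing.Linear.on tensor_comul.

Definition tensor_counit : C ⊗ D -> k :=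
  tlift (W := k^o) (fun c d => counit c * counit d).

Lemma bilinear_tensor_counit :
  bilinear_fun (fun (c : C) (d : D) => counit c * counit d : k^o).
Proof.
split=> [d a x y|c a x y]; rewrite linearP ?mulrDl ?mulrDr -?mulrA //.
by rewrite mulrCA.
Qed.

Fact tensor_counit_linear : scalar tensor_counit.
Proof. exact: tlift_linear bilinear_tensor_counit. Qed.
HB.instance Definition _ :=
  GRing.isLinear.Build k (C ⊗ D)%type k _ tensor_counit tensor_counit_linear.

Lemma tensor_counitE c d : tensor_counit (c ⊗ d) = counit c * counit d.
Proof. exact: tlift_tens bilinear_tensor_counit. Qed.

Lemma tensor_comulE c d : tensor_comul (c ⊗ d) = tmid (comul c ⊗ comul d).
Proof. by rewrite /tensor_comul /= tmapE. Qed.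

Fact tensor_comulA x :
  tassoc (tmap tensor_comul idfun (tensor_comul x)) =
  tmap idfun tensor_comul (tensor_comul x).
Proof.
pose M : {linear ((C ⊗ (C ⊗ C)) ⊗ (D ⊗ (D ⊗ D)))%type ->
    ((C ⊗ D) ⊗ ((C ⊗ D) ⊗ (C ⊗ D)))%type} :=
  tmap idfun (@tmid k C C D D) \o @tmid k C (C ⊗ C)%type D (D ⊗ D)%type.
have L1 (b : C) (d : D) (p : C ⊗ C) (q : D ⊗ D) :
    tassoc (tmid (p ⊗ q) ⊗ (b ⊗ d)) = M (tassoc (p ⊗ b) ⊗ tassoc (q ⊗ d)).
  move: p; apply: tensor_ext => [r u v|r u v|y z].
  - by rewrite tens_linearl linearP tens_linearl linearP.
  - by rewrite tens_linearl linearP tens_linearl linearP.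
  move: q; apply: tensor_ext => [r u v|r u v|y' z'].
  - by rewrite linearP linearP tens_linearl linearP.
  - by rewrite tens_linearl linearP !linearP.
  by rewrite tmidE !tassocE /M /= tmidE tmapE /= tmidE.
have L2 (a : C) (c : D) (p : C ⊗ C) (q : D ⊗ D) :
    (a ⊗ c) ⊗ tmid (p ⊗ q) = M ((a ⊗ p) ⊗ (c ⊗ q)).
  by rewrite /M /= tmidE tmapE.
have E : tassoc \o tmap tensor_comul idfun \o tmid =1
    M \o tmap (tassoc \o tmap comul idfun) (tassoc \o tmap comul idfun).
  apply: tensor_ext4 => a b c d /=.
  rewrite tmidE !tmapE /= tensor_comulE !tmapE /=.
  exact: L1.
have E' : tmap idfun tensor_comul \o tmid =1
    M \o tmap (tmap idfun comul) (tmap idfun comul).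
  apply: tensor_ext4 => a b c d /=.
  by rewrite tmidE !tmapE /= tensor_comulE !tmapE; apply: L2.
move: x; apply: tensor_ext => [r u v|r u v|c0 d0].
- by rewrite !linearP.
- by rewrite !linearP.
rewrite tensor_comulE; have /= -> := E (comul c0 ⊗ comul d0).
have /= -> := E' (comul c0 ⊗ comul d0).
by rewrite !tmapE /= !comulA.
Qed.

Fact tensor_comul_counitl x : tforml tensor_counit (tensor_comul x) = x.
Proof.
have E : tforml tensor_counit \o tmid =1
    tmap (@tforml _ C C counit) (@tforml _ D D counit).
  apply: tensor_ext4 => a b c d /=.
  rewrite tmidE tmapE /= !tformlE /= tensor_counitE tens_linearZl linearZ /=.
  by rewrite scalerA.
move: x; apply: tensor_ext => [r u v|r u v|c0 d0]; rewrite ?linearP //.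
rewrite tensor_comulE; have /= -> := E (comul c0 ⊗ comul d0).
by rewrite tmapE /= !comul_counitl.
Qed.

Fact tensor_comul_counitr x : tformr tensor_counit (tensor_comul x) = x.
Proof.
have E : tformr tensor_counit \o tmid =1
    tmap (@tformr _ C C counit) (@tformr _ D D counit).
  apply: tensor_ext4 => a b c d /=.
  rewrite tmidE tmapE /= !tformrE /= tensor_counitE tens_linearZl linearZ /=.
  by rewrite scalerA.
move: x; apply: tensor_ext => [r u v|r u v|c0 d0]; rewrite ?linearP //.
rewrite tensor_comulE; have /= -> := E (comul c0 ⊗ comul d0).
by rewrite tmapE /= !comul_counitr.
Qed.

HB.instance Definition _ := Lmodule_isCoalgebra.Build k (tensor_sort C D)
  tensor_comulA tensor_comul_counitl tensor_comul_counitr.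

End TensorCoalgebra.

Definition cop (k : fieldType) (C : coalgType k) : Type := C.

Section OppositeCoalgebra.
Variables (k : fieldType) (C : coalgType k).

HB.instance Definition _ := GRing.Lmodule.copy (cop C) C.

Definition cop_comul : C -> C ⊗ C := @tswap k C C \o comul.
HB.instance Definition _ := GRing.Linear.on cop_comul.

Fact cop_comulA (c : C) :
  tassoc (tmap cop_comul idfun (cop_comul c)) =
  tmap idfun cop_comul (cop_comul c).
Proof.
pose R : {linear (C ⊗ (C ⊗ C))%type -> (C ⊗ (C ⊗ C))%type} :=
  @tassoc k C C C \o @tswap k C (C ⊗ C)%type \o tmap idfun (@tswap k C C).
have E1 : @tassoc k C C C \o tmap cop_comul idfun \o @tswap k C C =1
    R \o tmap idfun (@comul k C).
  apply: tensor_ext => [r u v|r u v|x y]; rewrite ?linearP //=.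
  by rewrite tswapE !tmapE /= ?tmapE /= tswapE.
have E2 : tmap idfun cop_comul \o @tswap k C C =1
    R \o tassoc \o tmap (@comul k C) idfun.
  apply: tensor_ext => [r u v|r u v|x y]; rewrite ?linearP //=.
  rewrite tswapE !tmapE /=.
  have L (p : C ⊗ C) : y ⊗ tswap p = R (tassoc (p ⊗ y)).
    move: p; apply: tensor_ext => [r u v|r u v|x' y'].
    - by rewrite !linearP.
    - by rewrite tens_linearl !linearP.
    by rewrite tassocE /R /= tmapE /= !tswapE tassocE.
  exact: L.
have /= -> := E1 (comul c); have /= -> := E2 (comul c).
by rewrite -comulA.
Qed.

Fact cop_counitl (c : C) : tforml counit (cop_comul c) = c.
Proof.
have E : tforml counit \o @tswap k C C =1 tformr counit.
  apply: tensor_ext => [r u v|r u v|x y]; rewrite ?linearP //=.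
  by rewrite tswapE tformlE tformrE.
by have /= -> := E (comul c); rewrite comul_counitr.
Qed.

Fact cop_counitr (c : C) : tformr counit (cop_comul c) = c.
Proof.
have E : tformr counit \o @tswap k C C =1 tforml counit.
  apply: tensor_ext => [r u v|r u v|x y]; rewrite ?linearP //=.
  by rewrite tswapE tformlE tformrE.
by have /= -> := E (comul c); rewrite comul_counitl.
Qed.

HB.instance Definition _ := Lmodule_isCoalgebra.Build k (cop C)
  cop_comulA cop_counitl cop_counitr.

End OppositeCoalgebra.

HB.mixin Record isHopfAlgebra (k : fieldType) H
    of GRing.Algebra k H & Coalgebra k H := {
  comul1_subproof : comul (1 : H) = 1 ⊗ 1;
  comulM_subproof : forall x y : H, comul (x * y) =
    \sw_(x1, x2 <- x) \sw_(y1, y2 <- y) (x1 * y1) ⊗ (x2 * y2);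
  counit1_subproof : counit (1 : H) = 1;
  counitM_subproof : forall x y : H, counit (x * y) = counit x * counit y;
  antipode_subdef : {linear H -> H};
  antipodel_subproof : forall x : H,
    \sw_(x1, x2 <- x) antipode_subdef x1 * x2 = counit x *: 1;
  antipoder_subproof : forall x : H,
    \sw_(x1, x2 <- x) x1 * antipode_subdef x2 = counit x *: 1
}.

#[short(type="hopfAlgType")]
HB.structure Definition HopfAlgebra (k : fieldType) :=
  {H of GRing.Algebra k H & Coalgebra k H & isHopfAlgebra k H}.

Section HopfAlgebraTheory.
Variables (k : fieldType) (H : hopfAlgType k).

Definition antipode : {linear H -> H} := antipode_subdef.

Lemma comul1 : comul (1 : H) = 1 ⊗ 1.
Proof. exact: comul1_subproof. Qed.

Lemma comulM (x y : H) : comul (x * y) =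
  \sw_(x1, x2 <- x) \sw_(y1, y2 <- y) (x1 * y1) ⊗ (x2 * y2).
Proof. exact: comulM_subproof. Qed.

Lemma counit1 : counit (1 : H) = 1.
Proof. exact: counit1_subproof. Qed.

Lemma counitM (x y : H) : counit (x * y) = counit x * counit y.
Proof. exact: counitM_subproof. Qed.

Lemma antipodel (x : H) :
  \sw_(x1, x2 <- x) antipode x1 * x2 = counit x *: 1.
Proof. exact: antipodel_subproof. Qed.

Lemma antipoder (x : H) :
  \sw_(x1, x2 <- x) x1 * antipode x2 = counit x *: 1.
Proof. exact: antipoder_subproof. Qed.

End HopfAlgebraTheory.

(** The inverse of a bijection f (0 outside of the range of f). *)
Definition inv_map (k : fieldType) (U V : lmodType k) (f : U -> V) (y : V) : U :=
  if pselect (exists x, f x == y) is left fx then xchoose fx else 0.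

Lemma inv_mapK (k : fieldType) (U V : lmodType k) (f : U -> V) :
  bijective f -> cancel f (inv_map f).
Proof.
move=> bf x; apply: (bij_inj bf); rewrite /inv_map.
case: pselect => [fx|[]]; last by exists x.
exact/eqP/(xchooseP fx).
Qed.

Lemma inv_mapKV (k : fieldType) (U V : lmodType k) (f : U -> V) :
  bijective f -> cancel (inv_map f) f.
Proof. by move=> bf y; have [g _ gK] := bf; rewrite -[y]gK inv_mapK. Qed.

Section Solutions.
Variables (k : fieldType) (H : coalgType k) (s : H ⊗ H -> H ⊗ H).

(** s ⊗ H and H ⊗ s, as endomorphisms of (H ⊗ H) ⊗ H. *)
Definition map12 : (H ⊗ H) ⊗ H -> (H ⊗ H) ⊗ H := tmap s idfun.
Definition map23 : (H ⊗ H) ⊗ H -> (H ⊗ H) ⊗ H :=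
  tassocI \o tmap idfun s \o tassoc.

Definition braid_equation : Prop :=
  map12 \o map23 \o map12 =1 map23 \o map12 \o map23.

Definition set_theoretic_solution : Prop :=
  coalg_morphism s /\ braid_equation.

Definition s_1 : H ⊗ H -> H := tformr counit \o s.
Definition s_2 : H ⊗ H -> H := tforml counit \o s.

Definition G_s : H ⊗ H -> H ⊗ H :=
  tlift (fun h l => \sw_(l1, l2 <- l) s_2 (h ⊗ l1) ⊗ l2).

Definition left_nondegenerate : Prop := bijective G_s.

Definition dot_op : H ⊗ H -> H := tformr counit \o inv_map G_s.
Definition colon_op : H ⊗ H -> H :=
  tlift (fun h l => \sw_(h1, h2 <- h) s_1 (dot_op (l ⊗ h1) ⊗ h2)).

End Solutions.

Definition mul_map (k : fieldType) (H : hopfAlgType k) : H ⊗ H -> H :=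
  tlift (fun x y => x * y).
Arguments mul_map {k H}.

Definition weak_braiding_operator (k : fieldType) (H : hopfAlgType k)
    (s : H ⊗ H -> H ⊗ H) : Prop :=
  [/\ set_theoretic_solution s,
      s \o tmap mul_map idfun =1
        tmap idfun mul_map \o tassoc \o map12 s \o map23 s,
      s \o tmap idfun mul_map \o tassoc =1
        tmap mul_map idfun \o map23 s \o map12 s,
      forall h, s (1 ⊗ h) = h ⊗ 1
    & forall h, s (h ⊗ 1) = 1 ⊗ h].

Section ModuleCoalgebra.
Variables (k : fieldType) (H : hopfAlgType k) (C : coalgType k).

Definition right_module_coalgebra (act : C ⊗ H -> C) : Prop :=
  [/\ coalg_morphism act,
      forall c, act (c ⊗ 1) = c
    & forall c h h', act (c ⊗ (h * h')) = act (act (c ⊗ h) ⊗ h')].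

Definition left_module_coalgebra (act : H ⊗ C -> C) : Prop :=
  [/\ coalg_morphism act,
      forall c, act (1 ⊗ c) = c
    & forall h h' c, act ((h * h') ⊗ c) = act (h ⊗ act (h' ⊗ c))].

End ModuleCoalgebra.

Section MatchedPair.
Variables (k : fieldType) (H : hopfAlgType k) (ract lact : H ⊗ H -> H).

Local Notation "h ◁ l" := (ract (h ⊗ l)).
Local Notation "h ▷ l" := (lact (h ⊗ l)).

Record matched_pair : Prop := MatchedPair {
  matched_pair_right : right_module_coalgebra ract;
  matched_pair_left : left_module_coalgebra lact;
  matched_pair_mulr : forall l h h' : H, l ▷ (h * h') =
    \sw_(l1, l2 <- l) \sw_(h1, h2 <- h) (l1 ▷ h1) * ((l2 ◁ h2) ▷ h');
  matched_pair_mull : forall l' l h : H, (l' * l) ◁ h =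
    \sw_(l1, l2 <- l) \sw_(h1, h2 <- h) (l' ◁ (l1 ▷ h1)) * (l2 ◁ h2);
  matched_pair_1l : forall h : H, 1 ◁ h = counit h *: 1;
  matched_pair_1r : forall l : H, l ▷ 1 = counit l *: 1;
  matched_pair_swap : forall l h : H,
    \sw_(l1, l2 <- l) \sw_(h1, h2 <- h) (l1 ▷ h1) ⊗ (l2 ◁ h2) =
    \sw_(l1, l2 <- l) \sw_(h1, h2 <- h) (l2 ▷ h2) ⊗ (l1 ◁ h1)
}.

End MatchedPair.

Section QCycleCoalgebra.
Variables (k : fieldType) (H : coalgType k) (dot colon : H ⊗ H -> H).

Local Notation "x · y" := (dot (x ⊗ y)).
Local Notation "x ∶ y" := (colon (x ⊗ y)).

(** The Sweedler components are those of H in both factors: [cop] only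
    changes the coalgebra structures of the source and the target. *)
Definition q_magma_map : H ⊗ cop H -> cop H ⊗ H :=
  tlift (fun x y : H =>
    \sw_(x1, x2 <- x) \sw_(y1, y2 <- y) (y1 ∶ x2) ⊗ (x1 · y2)).

Record q_magma_coalgebra : Prop := QMagmaCoalgebra {
  q_magma_dot_linear : linear dot;
  q_magma_colon_linear : linear colon;
  q_magma_counit_dot : forall x y, counit (x · y) = counit x * counit y;
  q_magma_counit_colon : forall x y, counit (x ∶ y) = counit x * counit y;
  q_magma_morphism :
    @coalg_morphism k (H ⊗ cop H)%type (cop H ⊗ H)%type q_magma_map
}.

Definition left_regular : Prop :=
  bijective (tlift (fun x y => \sw_(y1, y2 <- y) (x · y1) ⊗ y2)).

Record q_cycle_coalgebra : Prop := QCycleCoalgebra {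
  q_cycle_magma : q_magma_coalgebra;
  q_cycle_regular : left_regular;
  q_cycle_dot_dot : forall x y z : H,
    \sw_(y1, y2 <- y) (x · y1) · (z ∶ y2) =
    \sw_(z1, z2 <- z) (x · z2) · (y · z1);
  q_cycle_dot_colon : forall x y z : H,
    \sw_(y1, y2 <- y) (x · y1) ∶ (z · y2) =
    \sw_(z1, z2 <- z) (x ∶ z2) · (y ∶ z1);
  q_cycle_colon_colon : forall x y z : H,
    \sw_(y1, y2 <- y) (x ∶ y1) ∶ (z ∶ y2) =
    \sw_(z1, z2 <- z) (x ∶ z2) ∶ (y · z1)
}.

End QCycleCoalgebra.

Section HopfQBrace.
Variables (k : fieldType) (H : hopfAlgType k) (dot colon : H ⊗ H -> H).

Local Notation "x · y" := (dot (x ⊗ y)).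
Local Notation "x ∶ y" := (colon (x ⊗ y)).

(** The product of x and y in H^op is y * x. *)
Definition right_op_module (act : H ⊗ H -> H) : Prop :=
  [/\ linear act,
      forall h, act (h ⊗ 1) = h
    & forall h x y, act (h ⊗ (x * y)) = act (act (h ⊗ y) ⊗ x)].

Record Hopf_q_brace : Prop := HopfQBrace {
  q_brace_q_cycle : q_cycle_coalgebra dot colon;
  q_brace_dot_module : right_op_module dot;
  q_brace_colon_module : right_op_module colon;
  q_brace_mul_dot : forall h x l : H, (h * x) · l =
    \sw_(l1, l2 <- l) \sw_(x1, x2 <- x) (h · (l1 ∶ x2)) * (x1 · l2);
  q_brace_mul_colon : forall h x l : H, (h * x) ∶ l =
    \sw_(l1, l2 <- l) \sw_(x1, x2 <- x) (h ∶ (l1 · x2)) * (x1 ∶ l2)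
}.

End HopfQBrace.

(* Main.v *)
Require Import Defs.
From HB Require Import structures.
From mathcomp Require Import all_boot all_algebra ring.

Set Implicit Arguments.
Unset Strict Implicit.
Unset Printing Implicit Defensive.

Import GRing.Theory.
Local Open Scope ring_scope.

(** The coalgebra endomorphism s is written through its components
    x ▷ y (first) and x ◁ y (second).  Being a coalgebra morphism, it is recovered from
    them in two ways,
      s (x ⊗ y) = Σ (x1 ▷ y1) ⊗ (x2 ◁ y2) = Σ (x2 ▷ y2) ⊗ (x1 ◁ y1).

    Weak braiding operators and matched pairs.  The two sides of each axiom of a
    weak braiding operator are coalgebra morphisms into H ⊗ H, so they agree if
    and only if their two components do ([coalg_morphism_tens_eq]); the equations
    between components are the axioms of a matched pair ([braiding_mull],
    [braiding_mulr], [braiding_1l], [braiding_1r]), and the last of these axioms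
    is the equality of the two expressions of s.

    Matched pairs and Hopf q-braces.  Non-degeneracy says that y ↦ (- ◁ y), as an
    element of the convolution algebra Hom (H, End H), is invertible, with
    inverse y ↦ (- · y).  Uniqueness of convolution inverses takes the form of
    [conv_inverse_intertwine]: a linear map that is equivariant for two actions is
    equivariant for their inverses.  It turns every statement on ◁ into one on
    · and back; the module axioms ([ra_dot_mulr]) and the formulas for
    (x * y) ◁ z and (x * y) · z ([ra_dot_mull]) are exchanged in this way, the
    second with H acting on H ⊗ H and the multiplication as equivariant map.
    Statements on ▷ and ∶ are compared by substitution: s takes the value
    Σ (y ∶ x2) ⊗ x1 on Σ (x · y1) ⊗ y2 ([sol_dot]), and tensors of the latter form
    span H ⊗ H ([dot_surj]), so that an identity for ▷ may be tested there, where
    it becomes an identity for ∶ ([la_colon_mull], [la_colon_mulr]).  The unit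
    axioms 1 ◁ y = ε(y) 1 and x ▷ 1 = ε(x) 1 have to be derived from the brace
    axioms: for the second one, x ↦ x ▷ 1 is an idempotent of the convolution
    algebra Hom (H, H) and has a left inverse, its composite with the antipode.

    The q-cycle identities hold for every left non-degenerate solution.  The third
    leg of the braid equation says that the action of H ⊗ H given by
    (x, y ⊗ z) ↦ (x ◁ y) ◁ z is invariant under s; then so is its inverse
    (x, y ⊗ z) ↦ (x · z) · y, and this is the first identity, again after
    substituting Σ (y · z1) ⊗ z2.  The other two come from evaluating the whole
    braid equation on the graph of the inverse action ([dot2_graph]): there it
    reduces to one equation in H ⊗ H ([sol_colon_graph]), whose components
    are the second and the third identity. *)

(** * Multilinear expressions *)

Definition linmap (k : fieldType) (U V : lmodType k) (f : U -> V)
    (lf : linear f) : {linear U -> V} :=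
  HB.pack f (GRing.isLinear.Build k U V _ f lf).

Section Linearity.
Variable k : fieldType.
Implicit Types U V W : lmodType k.

Lemma lin_id U : linear (fun x : U => x).
Proof. by []. Qed.

Lemma lin_comp U V W (f : {linear V -> W}) (g : U -> V) :
  linear g -> linear (fun x => f (g x)).
Proof. by move=> lg a x y; rewrite lg linearP. Qed.

Lemma lin_tensl U V W (g : U -> V) (w : W) :
  linear g -> linear (fun x => g x ⊗ w).
Proof. by move=> lg a x y; rewrite lg tens_linearl. Qed.

Lemma lin_tensr U V W (g : U -> V) (w : W) :
  linear g -> linear (fun x => w ⊗ g x).
Proof. by move=> lg a x y; rewrite lg linearP. Qed.

Lemma lin_mull U (A : algType k) (g : U -> A) (b : A) :
  linear g -> linear (fun x => g x * b).
Proof. by move=> lg a x y; rewrite lg mulrDl scalerAl. Qed.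

Lemma lin_mulr U (A : algType k) (g : U -> A) (b : A) :
  linear g -> linear (fun x => b * g x).
Proof. by move=> lg a x y; rewrite lg mulrDr scalerAr. Qed.

Lemma lin_scaler U V (b : k) (g : U -> V) :
  linear g -> linear (fun x => b *: g x).
Proof. by move=> lg a x y; rewrite lg scalerDr !scalerA mulrC. Qed.

Lemma lin_scalel U V W (f : {scalar V}) (g : U -> V) (w : W) :
  linear g -> linear (fun x => f (g x) *: w).
Proof. by move=> lg a x y; rewrite lg linearP scalerDl scalerA. Qed.

Lemma lin_tlift_arg U V W (X : lmodType k) (f : V -> W -> X) (g : U -> V ⊗ W) :
  linear g -> bilinear_fun f -> linear (fun x => tlift f (g x)).
Proof. by move=> lg bf a x y; rewrite lg tlift_linear. Qed.

Lemma lin_tlift_fun U V W (X : lmodType k) (f : U -> V -> W -> X) (t : V ⊗ W) :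
  (forall v w, linear (fun x => f x v w)) -> linear (fun x => tlift (f x) t).
Proof.
by move=> lf a x y; rewrite -tlift_combE; apply: eq_tlift => v w; apply: lf.
Qed.

Lemma lin_sw_arg U (C : coalgType k) W (f : C -> C -> W) (g : U -> C) :
  linear g -> bilinear_fun f -> linear (fun x => sweedler (g x) f).
Proof. by move=> lg bf; apply: lin_tlift_arg => //; apply: lin_comp. Qed.

Lemma lin_sw_fun U (C : coalgType k) W (f : U -> C -> C -> W) (c : C) :
  (forall c1 c2, linear (fun x => f x c1 c2)) ->
  linear (fun x => sweedler c (f x)).
Proof. exact: lin_tlift_fun. Qed.

Lemma lin_bilinl U V W (X : lmodType k) (f : V -> W -> X) (g : U -> V) (w : W) :
  bilinear_fun f -> linear g -> linear (fun x => f (g x) w).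
Proof. by move=> [fl _] lg a x y; rewrite lg fl. Qed.

Lemma lin_bilinr U V W (X : lmodType k) (f : V -> W -> X) (g : U -> W) (v : V) :
  bilinear_fun f -> linear g -> linear (fun x => f v (g x)).
Proof. by move=> [_ fr] lg a x y; rewrite lg fr. Qed.

Lemma lin_compf U V (W : lmodType k) (f : V -> W) (g : U -> V) :
  linear f -> linear g -> linear (fun x => f (g x)).
Proof. by move=> lf lg a x y; rewrite lg lf. Qed.

End Linearity.

(** A Sweedler sum is meaningful only when its summand is multilinear, so almost
    every rewriting step below leaves linearity goals.  In these the variable
    occurs once, and the rules descend to its occurrence. *)
Ltac multilin := intros; cbv beta;
  lazymatch goal with
  | |- bilinear_fun _ => split; multilin
  | |- linear (fun x => x) => exact: lin_id
  | |- linear (fun x => @tens _ _ _ _ _) =>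
      first [apply: lin_tensl | apply: lin_tensr]; multilin
  | |- linear (fun x => @GRing.Linear.sort _ _ _ _ _ _) =>
      apply: lin_comp; multilin
  | |- linear (fun x => sweedler _ _) =>
      first [apply: lin_sw_arg | apply: lin_sw_fun]; multilin
  | |- linear (fun x => tlift _ _) =>
      first [apply: lin_tlift_arg | apply: lin_tlift_fun]; multilin
  | |- linear (fun x => _ * _) =>
      first [apply: lin_mull | apply: lin_mulr]; multilin
  | |- linear (fun x => _ *: _) =>
      first [apply: lin_scaler | apply: lin_scalel]; multilin
  | |- _ => first
    [ match goal with H : _ |- _ => solve [apply H] end
    | match goal with H : linear _ |- _ => apply: (lin_compf H); multilin end
    | match goal with H : bilinear_fun _ |- _ =>
        first [apply: (lin_bilinl _ H) | apply: (lin_bilinr _ H)]; multilin end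
    | apply: lin_tensr; multilin | apply: lin_mulr; multilin
    | apply: lin_tlift_arg; multilin
    | apply: lin_comp; multilin ]
  end.

(** * Sweedler calculus *)

Section Sweedler.
Variables (k : fieldType) (C : coalgType k).
Implicit Types U V W : lmodType k.

Lemma eq_sw W (c : C) (f g : C -> C -> W) :
  (forall a b, f a b = g a b) -> sweedler c f = sweedler c g.
Proof. exact: eq_tlift. Qed.

Lemma linear_tlift V W (X Y : lmodType k) (f : {linear X -> Y}) (t : V ⊗ W) (E : V -> W -> X) :
  f (tlift E t) = tlift (fun a b => f (E a b)) t.
Proof. exact: raddf_sum. Qed.

Lemma tlift_lin V W (X Y : lmodType k) (f : X -> Y) (t : V ⊗ W) (E : V -> W -> X) :
  linear f -> f (tlift E t) = tlift (fun a b => f (E a b)) t.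
Proof. by move=> lf; rewrite -[f]/(linmap lf : _ -> _) linear_tlift. Qed.

Lemma linear_sw V W (f : {linear V -> W}) (c : C) (E : C -> C -> V) :
  f (\sw_(a, b <- c) E a b) = \sw_(a, b <- c) f (E a b).
Proof. exact: raddf_sum. Qed.

Lemma scalar_sw V (f : {scalar V}) (c : C) (E : C -> C -> V) :
  f (\sw_(a, b <- c) E a b) = sweedler (W := k^o) c (fun a b => f (E a b)).
Proof. exact: raddf_sum. Qed.

Lemma sw_lin V W (L : V -> W) (c : C) (E : C -> C -> V) :
  linear L -> \sw_(a, b <- c) L (E a b) = L (\sw_(a, b <- c) E a b).
Proof. by move=> lL; rewrite -[L]/(linmap lL : _ -> _) linear_sw. Qed.

Lemma tlift_sw (X : lmodType k) V W (E : V -> W -> X) (c : C)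
    (f : C -> C -> V ⊗ W) : bilinear_fun E ->
  tlift E (\sw_(a, b <- c) f a b) = \sw_(a, b <- c) tlift E (f a b).
Proof. by move=> bE; rewrite -[tlift E]/(linmap (tlift_linear bE) : _ -> _) linear_sw. Qed.

Lemma tens_swl V W (c : C) (E : C -> C -> V) (w : W) :
  (\sw_(a, b <- c) E a b) ⊗ w = \sw_(a, b <- c) E a b ⊗ w.
Proof.
exact: (linear_sw (linmap (tens_linearl w))).
Qed.

Lemma tens_swr V W (c : C) (E : C -> C -> V) (w : W) :
  w ⊗ (\sw_(a, b <- c) E a b) = \sw_(a, b <- c) w ⊗ E a b.
Proof. exact: linear_sw. Qed.

(** Both sides are one finite double sum over representatives of the two
    coproducts. *)
Lemma sw_exchange (D : coalgType k) W (c : C) (d : D) (E : C -> C -> D -> D -> W) :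
  \sw_(c1, c2 <- c) \sw_(d1, d2 <- d) E c1 c2 d1 d2 =
  \sw_(d1, d2 <- d) \sw_(c1, c2 <- c) E c1 c2 d1 d2.
Proof. exact: exchange_big. Qed.

(** Coassociativity, oriented so as to nest iterated sums to the right; this is
    the normal form in which the factors x1, x2, ... of an iterated coproduct appear
    in their order, and in which neighbouring factors can be grouped again. *)
Lemma sw_coassoc W (c : C) (E : C -> C -> C -> W) :
  (forall y z, linear (fun x => E x y z)) ->
  (forall x z, linear (fun y => E x y z)) ->
  (forall x y, linear (fun z => E x y z)) ->
  \sw_(a, b <- c) \sw_(a1, a2 <- a) E a1 a2 b =
  \sw_(a, b <- c) \sw_(b1, b2 <- b) E a b1 b2.
Proof.
move=> E1 E2 E3.
pose L := tlift (fun a (bc : C ⊗ C) => tlift (fun b c => E a b c) bc).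
have bL a : bilinear_fun (fun b c => E a b c) by multilin.
have bL' : bilinear_fun (fun a (bc : C ⊗ C) => tlift (fun b c => E a b c) bc).
  by multilin.
have lL : linear L by apply: tlift_linear.
pose fL := linmap lL.
have -> : \sw_(a, b <- c) \sw_(b1, b2 <- b) E a b1 b2 = L (tmap idfun comul (comul c)).
  rewrite [tmap _ _ _](_ : _ = \sw_(a, b <- c) a ⊗ comul b) //.
  rewrite -[L]/(fL : _ -> _) linear_sw; apply: eq_sw => a b.
  by rewrite /= /L tlift_tens.
rewrite -comulA.
rewrite [tmap _ _ _](_ : _ = \sw_(a, b <- c) comul a ⊗ b) //.
rewrite linear_sw -[L]/(fL : _ -> _) linear_sw; apply: eq_sw => a b.
have -> : comul a = \sw_(a1, a2 <- a) a1 ⊗ a2 by rewrite [LHS]tensor_sumE.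
rewrite tens_swl !linear_sw; apply: eq_sw => a1 a2.
by rewrite /= tassocE /L !tlift_tens.
Qed.

Lemma sw_counitl W (c : C) (E : C -> W) :
  linear E -> \sw_(a, b <- c) counit a *: E b = E c.
Proof.
move=> lE; rewrite -[in RHS](comul_counitl c) -[E in RHS]/(linmap lE : _ -> _).
rewrite linear_tlift; apply: eq_tlift => a b.
by rewrite linearZ.
Qed.

Lemma sw_counitr W (c : C) (E : C -> W) :
  linear E -> \sw_(a, b <- c) counit b *: E a = E c.
Proof.
move=> lE; rewrite -[in RHS](comul_counitr c) -[E in RHS]/(linmap lE : _ -> _).
rewrite linear_tlift; apply: eq_tlift => a b.
by rewrite linearZ.
Qed.

Lemma comul_sw (c : C) : comul c = \sw_(a, b <- c) a ⊗ b.
Proof. exact: tensor_sumE. Qed.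

Lemma sw_morph (D : coalgType k) W (f : C -> D) (c : C) (E : D -> D -> W) :
  coalg_morphism f -> bilinear_fun E ->
  sweedler (f c) E = \sw_(a, b <- c) E (f a) (f b).
Proof.
move=> [_ fD _] bE; rewrite /sweedler fD.
rewrite -[tlift E]/(linmap (tlift_linear bE) : _ -> _) linear_tlift.
by apply: eq_tlift => a b; rewrite /= tlift_tens.
Qed.

End Sweedler.

Section SweedlerTensor.
Variables (k : fieldType) (C D : coalgType k).

Lemma sw_tens (W : lmodType k) (c : C) (d : D)
    (E : (C ⊗ D)%type -> (C ⊗ D)%type -> W) : bilinear_fun E ->
  sweedler (c ⊗ d) E =
  \sw_(c1, c2 <- c) \sw_(d1, d2 <- d) E (c1 ⊗ d1) (c2 ⊗ d2).
Proof.
move=> bE; rewrite [LHS](_ : _ = tlift E (tmid (comul c ⊗ comul d))); last first.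
  by rewrite -tensor_comulE.
rewrite (comul_sw c) (comul_sw d).
rewrite -[tlift E]/(linmap (tlift_linear bE) : _ -> _).
rewrite tens_swl !linear_sw; apply: eq_sw => c1 c2.
rewrite tens_swr !linear_sw; apply: eq_sw => d1 d2.
by rewrite /= tmidE /= tlift_tens.
Qed.

Lemma counit_tens (c : C) (d : D) :
  counit (c ⊗ d) = counit c * counit d.
Proof. exact: tensor_counitE. Qed.

(** Used with a formula for the coproduct of an operation applied to c and d. *)
Lemma sw_comul (B : coalgType k) (W : lmodType k) (b : B) (c : C) (d : D)
    (f g : C -> C -> D -> D -> B) (E : B -> B -> W) :
  comul b = \sw_(c1, c2 <- c) \sw_(d1, d2 <- d) f c1 c2 d1 d2 ⊗ g c1 c2 d1 d2 ->
  bilinear_fun E ->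
  sweedler b E =
  \sw_(c1, c2 <- c) \sw_(d1, d2 <- d) E (f c1 c2 d1 d2) (g c1 c2 d1 d2).
Proof.
move=> bE lE; rewrite /sweedler bE -[tlift E]/(linmap (tlift_linear lE) : _ -> _).
rewrite linear_sw; apply: eq_sw => c1 c2; rewrite linear_sw.
by apply: eq_sw => d1 d2; rewrite /= tlift_tens.
Qed.

End SweedlerTensor.

(** The right-hand side isolates the two middle factors of a fourfold coproduct,
    so that an identity on them can be applied. *)
Lemma sw_coassoc4 (k : fieldType) (C : coalgType k) (W : lmodType k) (c : C)
    (E : C -> C -> C -> C -> W) :
  (forall y z t, linear (fun x => E x y z t)) ->
  (forall x z t, linear (fun y => E x y z t)) ->
  (forall x y t, linear (fun z => E x y z t)) ->
  (forall x y z, linear (fun t => E x y z t)) ->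
  \sw_(a, b <- c) \sw_(a1, a2 <- a) \sw_(b1, b2 <- b) E a1 a2 b1 b2 =
  \sw_(x, y <- c) \sw_(z, t <- y) \sw_(z1, z2 <- z) E x z1 z2 t.
Proof.
move=> E1 E2 E3 E4.
rewrite sw_coassoc; [|by multilin..]; apply: eq_sw => x y.
by rewrite -sw_coassoc //; multilin.
Qed.

Lemma sw_cop (k : fieldType) (C : coalgType k) (W : lmodType k) (c : C)
    (E : C -> C -> W) : bilinear_fun E ->
  sweedler (C := cop C) c E = \sw_(a, b <- c) E b a.
Proof.
move=> bE.
rewrite -[LHS]/(tlift E (tswap (comul c))) /tswap (tlift_lin _ _ (tlift_linear bE)).
by apply: eq_tlift => a b; rewrite tlift_tens.
Qed.

(** * Convolution inverses *)

Section ConvolutionInverse.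
Variables (k : fieldType) (C : coalgType k).

(** F and P are families of endomorphisms of M indexed by C, that is, elements of
    the convolution algebra Hom (C, End M); the product with F applied after P
    is required to be the unit.  This is one half of invertibility. *)
Definition conv_inverse (M : lmodType k) (F P : M -> C -> M) : Prop :=
  forall x c, \sw_(a, b <- c) F (P x a) b = counit c *: x.

Lemma conv_inverseE (M W : lmodType k) (F P : M -> C -> M) (L : M -> W) x c :
  conv_inverse F P -> linear L ->
  \sw_(a, b <- c) L (F (P x a) b) = counit c *: L x.
Proof. by move=> FP lL; rewrite sw_lin // FP (linear_funZ _ _ lL). Qed.

(** The form in which two neighbouring factors cancel in the midst of a
    right-nested sum. *)
Lemma conv_inverse_tail (M W : lmodType k) (F P : M -> C -> M)
    (E : M -> C -> W) x c :
  bilinear_fun F -> bilinear_fun P -> conv_inverse F P -> bilinear_fun E ->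
  \sw_(a, b <- c) \sw_(b1, b2 <- b) E (F (P x a) b1) b2 = E x c.
Proof.
move=> bF bP FP bE; rewrite -sw_coassoc; [|by multilin..].
rewrite -(sw_counitl c (E := E x)); last by multilin.
apply: eq_sw => a b.
by rewrite (conv_inverseE (L := E^~ b) _ _ FP); last by multilin.
Qed.

(** Uniqueness of inverses:
    P' (phi x) c = Σ P' (phi (F (P x c1) c2)) c3 = Σ P' (F' (phi (P x c1)) c2) c3
    = phi (P x c).  With phi = id this says that equal actions have equal
    inverses. *)
Lemma conv_inverse_intertwine (M N : lmodType k)
    (F P : M -> C -> M) (F' P' : N -> C -> N) (phi : {linear M -> N}) :
  bilinear_fun F -> bilinear_fun P -> bilinear_fun F' -> bilinear_fun P' ->
  conv_inverse F P -> conv_inverse P' F' ->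
  (forall x c, phi (F x c) = F' (phi x) c) ->
  forall x c, phi (P x c) = P' (phi x) c.
Proof.
move=> bF bP bF' bP' FP PF phiF x c.
rewrite -(sw_counitl c (E := P' (phi x))); last by multilin.
symmetry.
transitivity (\sw_(a, b <- c) \sw_(a1, a2 <- a) P' (F' (phi (P x a1)) a2) b).
  apply: eq_sw => a b; rewrite -(conv_inverseE (L := fun y => P' (phi y) b) _ _ FP).
    by apply: eq_sw => a1 a2; rewrite phiF.
  by multilin.
rewrite sw_coassoc.
  - rewrite -(sw_counitr c (E := fun a => phi (P x a))); last by multilin.
    by apply: eq_sw => a b; exact: PF.
  - multilin.
  - multilin.
  - multilin.
Qed.

End ConvolutionInverse.

Section ConvolutionTensor.
Variables (k : fieldType) (C D : coalgType k) (M : lmodType k).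

Lemma conv_inverse_pullback (F P : M -> C -> M) (f : D -> C) :
  bilinear_fun F -> bilinear_fun P -> coalg_morphism f -> conv_inverse F P ->
  conv_inverse (fun x d => F x (f d)) (fun x d => P x (f d)).
Proof.
move=> bF bP fM FP x d; have [_ _ <-] := fM; rewrite -FP sw_morph //.
by split=> [v|u]; multilin.
Qed.

(** The inverse of a composite composes the inverses in the opposite order,
    although the coalgebra C ⊗ D still lists the factor of C first.  This
    lemma and the next are the two orders of composition. *)
Lemma conv_inverse_tensor (F P : M -> C -> M) (F' P' : M -> D -> M) :
  bilinear_fun F -> bilinear_fun P -> bilinear_fun F' -> bilinear_fun P' ->
  conv_inverse F P -> conv_inverse F' P' ->
  conv_inverse (fun x => tlift (fun c d => F' (F x c) d))
    (fun x => tlift (fun c d => P (P' x d) c)).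
Proof.
move=> bF bP bF' bP' FP FP' x t; move: t; apply: tensor_ext.
- by multilin.
- by multilin.
move=> c d; rewrite sw_tens; last by multilin.
transitivity (\sw_(c1, c2 <- c) \sw_(d1, d2 <- d) F' (F (P (P' x d1) c1) c2) d2).
  apply: eq_sw => c1 c2; apply: eq_sw => d1 d2.
  by rewrite !tlift_tens //; multilin.
rewrite sw_exchange.
under eq_sw => d1 d2 do
  [rewrite (conv_inverseE (L := F'^~ d2) _ _ FP); last by multilin].
rewrite (sw_lin (L := fun y => counit c *: y)); last by multilin.
by rewrite FP' scalerA counit_tens.
Qed.

Lemma conv_inverse_tensor_swap (F P : M -> C -> M) (F' P' : M -> D -> M) :
  bilinear_fun F -> bilinear_fun P -> bilinear_fun F' -> bilinear_fun P' ->
  conv_inverse F P -> conv_inverse F' P' ->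
  conv_inverse (fun x => tlift (fun c d => F (F' x d) c))
    (fun x => tlift (fun c d => P' (P x c) d)).
Proof.
move=> bF bP bF' bP' FP FP' x t; move: t; apply: tensor_ext.
- by multilin.
- by multilin.
move=> c d; rewrite sw_tens; last by multilin.
transitivity (\sw_(c1, c2 <- c) \sw_(d1, d2 <- d) F (F' (P' (P x c1) d1) d2) c2).
  apply: eq_sw => c1 c2; apply: eq_sw => d1 d2.
  by rewrite !tlift_tens //; multilin.
under eq_sw => c1 c2 do
  [rewrite (conv_inverseE (L := F^~ c2) _ _ FP'); last by multilin].
rewrite (sw_lin (L := fun y => counit d *: y)); last by multilin.
by rewrite FP scalerA counit_tens mulrC.
Qed.

End ConvolutionTensor.

(** * Coalgebra morphisms between tensor products *)

Section CoalgebraMorphisms.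
Variables (k : fieldType) (C D : coalgType k).

Lemma tformr_tforml_comul (t : C ⊗ D) :
  tmap (tformr counit) (tforml counit) (comul t) = t.
Proof.
move: t; apply: tensor_ext => [||c d]; [by multilin|by multilin|].
rewrite comul_sw (linear_sw (tmap _ _)) sw_tens; last by multilin.
under eq_sw => c1 c2 do under eq_sw => d1 d2 do
  rewrite /= tmapE /= tformlE tformrE /= tens_linearZl.
under eq_sw => c1 c2.
  rewrite (sw_counitl _ (E := fun u => c1 ⊗ (counit c2 *: u))); last by multilin.
  rewrite linearZ /=; over.
by rewrite (sw_counitr _ (E := fun u => u ⊗ d)); last by multilin.
Qed.

Lemma tforml_tformr_comul (t : C ⊗ D) :
  tmap (tforml counit) (tformr counit) (comul t) = tswap t.
Proof.
move: t; apply: tensor_ext => [||c d]; [by multilin|by multilin|].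
rewrite comul_sw (linear_sw (tmap _ _)) sw_tens; last by multilin.
under eq_sw => c1 c2 do under eq_sw => d1 d2 do
  rewrite /= tmapE /= tformlE tformrE /= tens_linearZl linearZ /=.
under eq_sw => c1 c2.
  rewrite sw_lin; last by multilin.
  rewrite (sw_counitr _ (E := fun u => u ⊗ c2)); last by multilin.
  over.
by rewrite (sw_counitl _ (E := fun u => d ⊗ u)) ?tswapE //; multilin.
Qed.

Lemma coalg_morphism_tformr : coalg_morphism (@tformr k C D counit).
Proof.
split=> [|t|t]; first exact: linearP.
- move: t; apply: tensor_ext => [||c d]; [by multilin|by multilin|].
  rewrite tformrE linearZ /= (comul_sw (c ⊗ d)) (linear_sw (tmap _ _)).
  rewrite sw_tens; last by multilin.
  rewrite comul_sw -sw_lin; last by multilin.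
  apply: eq_sw => c1 c2.
  under eq_sw => d1 d2 do rewrite /= tmapE /= !tformrE /= tens_linearZl.
  rewrite (sw_counitl _ (E := fun u => c1 ⊗ (counit u *: c2))) ?linearZ //.
  by multilin.
- move: t; apply: (tensor_ext (W := k^o)) => [||c d].
  + by move=> a x y; rewrite !linearP.
  + exact: linearP.
  by rewrite tformrE linearZ /= tensor_counitE mulrC.
Qed.

Lemma coalg_morphism_tforml : coalg_morphism (@tforml k C D counit).
Proof.
split=> [|t|t]; first exact: linearP.
- move: t; apply: tensor_ext => [||c d]; [by multilin|by multilin|].
  rewrite tformlE linearZ /= (comul_sw (c ⊗ d)) (linear_sw (tmap _ _)).
  rewrite sw_tens; last by multilin.
  rewrite sw_exchange comul_sw -sw_lin; last by multilin.
  apply: eq_sw => d1 d2.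
  under eq_sw => c1 c2 do rewrite /= tmapE /= !tformlE /= tens_linearZl.
  rewrite (sw_counitl _ (E := fun u => d1 ⊗ (counit u *: d2))) ?linearZ //.
  by multilin.
- move: t; apply: (tensor_ext (W := k^o)) => [||c d].
  + by move=> a x y; rewrite !linearP.
  + exact: linearP.
  by rewrite tformlE linearZ /= tensor_counitE.
Qed.

Lemma coalg_morphism_tmap (C' D' : coalgType k) (f : C -> C') (g : D -> D') :
  coalg_morphism f -> coalg_morphism g -> coalg_morphism (tmap f g).
Proof.
move=> fM gM; have [lf _ fe] := fM; have [lg _ ge] := gM.
pose F := linmap lf; pose G := linmap lg.
rewrite -[f]/(F : _ -> _) -[g]/(G : _ -> _).
split=> [|t|t]; first exact: linearP.
- move: t; apply: tensor_ext => [||c d]; [by multilin|by multilin|].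
  rewrite tmapE (comul_sw (c ⊗ d)) (linear_sw (tmap _ _)) comul_sw.
  rewrite !sw_tens; [|by multilin..].
  rewrite [LHS](sw_morph (f := f)) //; last by multilin.
  apply: eq_sw => c1 c2; rewrite (sw_morph (f := g)) //; last by multilin.
  apply: eq_sw => d1 d2.
  rewrite [RHS](_ : _ = tmap F G (c1 ⊗ d1) ⊗ tmap F G (c2 ⊗ d2)).
    by rewrite !tmapE.
  exact: tmapE.
- move: t; apply: (tensor_ext (W := k^o)) => [||c d].
  + by move=> a x y; rewrite !linearP.
  + exact: linearP.
  by rewrite tmapE /= !tensor_counitE fe ge.
Qed.

End CoalgebraMorphisms.

Section CoalgebraMorphismsTheory.
Variables (k : fieldType) (B C D : coalgType k).

Lemma coalg_morphism_id : coalg_morphism (@idfun C).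
Proof.
split=> // c; rewrite [in RHS]comul_sw (linear_sw (tmap _ _)).
by rewrite [LHS]comul_sw; apply: eq_sw => a b; rewrite /= tmapE.
Qed.

Lemma coalg_morphism_comp (f : C -> D) (g : B -> C) :
  coalg_morphism f -> coalg_morphism g -> coalg_morphism (f \o g).
Proof.
move=> fM gM; have [lf fD fe] := fM; have [lg gD ge] := gM.
split=> [|b|b]; first by multilin.
- by rewrite /= comul_sw (sw_morph _ fM) ?(sw_morph _ gM) //; multilin.
- by rewrite /= fe ge.
Qed.

(** Applying f ⊗ f to a coproduct and projecting recovers f, hence f is determined
    by its two components. *)
Lemma coalg_morphism_tens_eq (f g : B -> C ⊗ D) :
  coalg_morphism f -> coalg_morphism g ->
  tformr counit \o f =1 tformr counit \o g ->
  tforml counit \o f =1 tforml counit \o g -> f =1 g.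
Proof.
move=> fM gM e1 e2 b; have [lf fD fe] := fM; have [lg gD ge] := gM.
have key (h : B -> C ⊗ D) : coalg_morphism h ->
    h b = \sw_(b1, b2 <- b) tformr counit (h b1) ⊗ tforml counit (h b2).
  move=> hM; rewrite -[LHS]tformr_tforml_comul comul_sw (linear_sw (tmap _ _)).
  rewrite (sw_morph _ hM); last by multilin.
  by apply: eq_sw => b1 b2; rewrite /= tmapE.
rewrite key // [RHS]key //; apply: eq_sw => b1 b2.
by congr (_ ⊗ _); [exact: e1|exact: e2].
Qed.

End CoalgebraMorphismsTheory.

Lemma tensor_ext3 (k : fieldType) (U V W X : lmodType k)
    (f g : (U ⊗ V) ⊗ W -> X) : linear f -> linear g ->
  (forall u v w, f (u ⊗ v ⊗ w) = g (u ⊗ v ⊗ w)) -> f =1 g.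
Proof.
move=> lf lg fg; apply: tensor_ext => // t w.
by move: t; apply: tensor_ext => [||u v]; [by multilin|by multilin|exact: fg].
Qed.

Lemma coalg_morphism_inverse (k : fieldType) (C D : coalgType k)
    (f : C -> D) (g : D -> C) :
  coalg_morphism f -> linear g -> cancel f g -> cancel g f -> coalg_morphism g.
Proof.
move=> fM lg fK gK; have [_ _ fe] := fM; split=> // d; last by rewrite -fe gK.
rewrite -[RHS]/(\sw_(d1, d2 <- d) g d1 ⊗ g d2) -[in RHS](gK d).
rewrite (sw_morph _ fM); last by multilin.
by rewrite [LHS]comul_sw; apply: eq_sw => c1 c2; rewrite !fK.
Qed.

Section Associativity.
Variables (k : fieldType) (A B C : coalgType k).

Lemma coalg_morphism_tassoc : coalg_morphism (@tassoc k A B C).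
Proof.
pose E (u v : (A ⊗ B) ⊗ C) := tassoc u ⊗ tassoc v.
have bE : bilinear_fun E by exact: bilinear_tmap.
pose f : {linear ((A ⊗ B) ⊗ C)%type -> _} := comul \o tassoc.
have fE : f =1 (fun t => sweedler t E).
  apply: tensor_ext3 => [||a b c]; first exact: linearP.
    exact: lin_sw_arg bE.
  rewrite /f /= tassocE sw_tens //.
  rewrite [LHS]comul_sw sw_tens; last by multilin.
  rewrite sw_tens; last by multilin.
  apply: eq_sw => a1 a2; rewrite sw_tens; last by multilin.
  apply: eq_sw => b1 b2; apply: eq_sw => c1 c2.
  by rewrite /E !tassocE.
split; [exact: linearP|exact: fE|].
pose g : {scalar ((A ⊗ B) ⊗ C)%type} := counit \o tassoc.
suff gE : g =1 counit by exact: gE.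
apply: (tensor_ext3 (X := k^o)) => [||a b c].
- exact: linearP.
- exact: linearP.
by rewrite /g /= tassocE !tensor_counitE /= !tensor_counitE mulrA.
Qed.

Lemma coalg_morphism_tassocI : coalg_morphism (@tassocI k A B C).
Proof.
apply: (coalg_morphism_inverse coalg_morphism_tassoc).
- exact: linearP.
- have E : tassocI \o tassoc =1 @idfun ((A ⊗ B) ⊗ C).
    apply: tensor_ext3; [exact: linearP|by []|] => a b c.
    by rewrite /= tassocE tassocIE.
  exact: E.
- have E : tassoc \o tassocI =1 @idfun (A ⊗ (B ⊗ C)).
    apply: tensor_ext; [exact: linearP|by []|] => a t'.
    move: t'; apply: tensor_ext; [by multilin|by multilin|] => b c.
    by rewrite /= tassocIE tassocE.
  exact: E.
Qed.

End Associativity.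

(** * The operations of a left non-degenerate coalgebra endomorphism *)

Section Operations.
Variables (k : fieldType) (H : coalgType k).
Variables (s : {linear (H ⊗ H)%type -> (H ⊗ H)%type}).
Variables (la ra dot colon : {linear (H ⊗ H)%type -> H}).

Local Notation "x ▷ y" := (la (x ⊗ y)).
Local Notation "x ◁ y" := (ra (x ⊗ y)).
Local Notation "x · y" := (dot (x ⊗ y)).
Local Notation "x ∶ y" := (colon (x ⊗ y)).

(** What is needed about a left non-degenerate coalgebra endomorphism s and its
    operations.  The two expressions of s differ in the order of the factors;
    [dotK] and [raK] say that · and ◁ are mutually inverse actions. *)
Record nondegenerate_ops : Prop := NondegenerateOps {
  comul_la : forall x y,
    comul (x ▷ y) = \sw_(x1, x2 <- x) \sw_(y1, y2 <- y) (x1 ▷ y1) ⊗ (x2 ▷ y2);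
  comul_ra : forall x y,
    comul (x ◁ y) = \sw_(x1, x2 <- x) \sw_(y1, y2 <- y) (x1 ◁ y1) ⊗ (x2 ◁ y2);
  counit_la : forall x y, counit (x ▷ y) = counit x * counit y;
  counit_ra : forall x y, counit (x ◁ y) = counit x * counit y;
  sol_morph : coalg_morphism s;
  sol_def : forall x y,
    s (x ⊗ y) = \sw_(x1, x2 <- x) \sw_(y1, y2 <- y) (x1 ▷ y1) ⊗ (x2 ◁ y2);
  sol_swap : forall x y,
    s (x ⊗ y) = \sw_(x1, x2 <- x) \sw_(y1, y2 <- y) (x2 ▷ y2) ⊗ (x1 ◁ y1);
  dotK : conv_inverse (fun x y => x ◁ y) (fun x y => x · y);
  raK : conv_inverse (fun x y => x · y) (fun x y => x ◁ y);
  colon_def : forall x y, y ∶ x = \sw_(y1, y2 <- y) (x · y1) ▷ y2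
}.

Hypothesis ops : nondegenerate_ops.

Lemma counit_dot x y : counit (x · y) = counit x * counit y.
Proof.
have /(congr1 counit) := dotK ops x y; rewrite scalar_sw linearZ /= mulrC => <-.
rewrite -[LHS](sw_counitr (W := k^o) y (E := fun y => counit (x · y))).
  by apply: (eq_sw (W := k^o)) => a b; rewrite (counit_ra ops) /= mulrC.
by multilin.
Qed.

(** The coproduct is equivariant for ◁ acting diagonally on H ⊗ H.  The inverse
    of the diagonal action is u ⊗ v ↦ Σ (u · y2) ⊗ (v · y1), with y1 and y2
    exchanged since it inverts a product. *)
Lemma comul_dot x y :
  comul (x · y) = \sw_(x1, x2 <- x) \sw_(y1, y2 <- y) (x1 · y2) ⊗ (x2 · y1).
Proof.
(* The diagonal action of ◁ and its inverse. *)
pose F (t : H ⊗ H) (y : H) : H ⊗ H :=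
  tlift (fun u v => \sw_(y1, y2 <- y) (u ◁ y1) ⊗ (v ◁ y2)) t.
pose P (t : H ⊗ H) (y : H) : H ⊗ H :=
  tlift (fun u v => \sw_(y1, y2 <- y) (u · y2) ⊗ (v · y1)) t.
have bF : bilinear_fun F by rewrite /F; multilin.
have bP : bilinear_fun P by rewrite /P; multilin.
have PF : conv_inverse P F.
  move=> t c; move: t; apply: tensor_ext; [by multilin|by multilin|] => u v.
  transitivity (\sw_(a, b <- c) \sw_(a1, a2 <- a) \sw_(b1, b2 <- b)
     ((u ◁ a1) · b2) ⊗ ((v ◁ a2) · b1)).
    apply: eq_sw => a b; rewrite /F tlift_tens; last by multilin.
    rewrite -(sw_lin (L := P^~ b)); last by multilin.
    by apply: eq_sw => a1 a2; rewrite /P tlift_tens; last by multilin.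
  rewrite sw_coassoc; [|by multilin..].
  transitivity (\sw_(a, b <- c) ((u ◁ a) · b) ⊗ v).
    apply: eq_sw => a b; rewrite -sw_coassoc; [|by multilin..].
    transitivity (\sw_(b1, b2 <- b) counit b1 *: (((u ◁ a) · b2) ⊗ v)).
      apply: eq_sw => b1 b2.
      by rewrite (conv_inverseE (L := fun w => _ ⊗ w) _ _ (raK ops)); last by multilin.
    by rewrite sw_counitl //; multilin.
  by rewrite (conv_inverseE (L := fun w => w ⊗ v) _ _ (raK ops)) //; multilin.
rewrite (conv_inverse_intertwine (phi := comul) _ _ bF bP (dotK ops) PF).
- rewrite /P -[comul x]/(comul x) -[LHS]/(sweedler x _).
  by [].
- by multilin.
- by multilin.
- move=> u c; rewrite (comul_ra ops) /F -[RHS]/(sweedler u _).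
  by [].
Qed.

Lemma sw_dot (W : lmodType k) (E : H -> H -> W) x y : bilinear_fun E ->
  sweedler (x · y) E = \sw_(x1, x2 <- x) \sw_(y1, y2 <- y) E (x1 · y2) (x2 · y1).
Proof. exact: sw_comul (comul_dot x y). Qed.

Lemma sw_la (W : lmodType k) (E : H -> H -> W) x y : bilinear_fun E ->
  sweedler (x ▷ y) E = \sw_(x1, x2 <- x) \sw_(y1, y2 <- y) E (x1 ▷ y1) (x2 ▷ y2).
Proof. exact: sw_comul (comul_la ops x y). Qed.

Lemma sol_tlift (W : lmodType k) (E : H -> H -> W) x y : bilinear_fun E ->
  tlift E (s (x ⊗ y)) = \sw_(x1, x2 <- x) \sw_(y1, y2 <- y) E (x1 ▷ y1) (x2 ◁ y2).
Proof.
move=> bE; rewrite (sol_def ops) tlift_sw //; apply: eq_sw => x1 x2.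
by rewrite tlift_sw //; apply: eq_sw => y1 y2; rewrite tlift_tens.
Qed.

Lemma sol_tlift_swap (W : lmodType k) (E : H -> H -> W) x y : bilinear_fun E ->
  tlift E (s (x ⊗ y)) = \sw_(x1, x2 <- x) \sw_(y1, y2 <- y) E (x2 ▷ y2) (x1 ◁ y1).
Proof.
move=> bE; rewrite (sol_swap ops) tlift_sw //; apply: eq_sw => x1 x2.
by rewrite tlift_sw //; apply: eq_sw => y1 y2; rewrite tlift_tens.
Qed.

(** Expanding s with the factors in reversed order puts (x · y2) and y3 side by
    side in (x1 · y2) ◁ y3, where they cancel. *)
Lemma sol_dot_tlift (W : lmodType k) (E : H -> H -> W) x y : bilinear_fun E ->
  \sw_(y1, y2 <- y) tlift E (s ((x · y1) ⊗ y2)) = \sw_(x1, x2 <- x) E (y ∶ x2) x1.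
Proof.
move=> bE.
transitivity (\sw_(a, b <- y) \sw_(x1, x2 <- x) \sw_(p, q <- a)
   \sw_(b1, b2 <- b) E ((x2 · p) ▷ b2) ((x1 · q) ◁ b1)).
  by apply: eq_sw => a b; rewrite sol_tlift_swap // sw_dot; last by multilin.
rewrite sw_exchange; apply: eq_sw => x1 x2; rewrite sw_coassoc; [|by multilin..].
rewrite (colon_def ops) -(sw_lin (L := E^~ x1)); last by multilin.
apply: eq_sw => p b.
by rewrite (conv_inverse_tail (E := fun u v => E ((x2 · p) ▷ v) u)
  _ _ _ _ (dotK ops)) //; multilin.
Qed.

Lemma sol_dot x y :
  \sw_(y1, y2 <- y) s ((x · y1) ⊗ y2) = \sw_(x1, x2 <- x) (y ∶ x2) ⊗ x1.
Proof.
rewrite -(sol_dot_tlift (E := fun u v => u ⊗ v)); last exact: tens_bilinear.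
by apply: eq_sw => y1 y2; exact: tensor_sumE.
Qed.

(** Expanding s in the other order in [sol_dot_tlift] leaves
    Σ ((x1 · y2) ▷ y3) ⊗ ((x2 · y1) ◁ y4) = Σ (y ∶ x2) ⊗ x1; acting by · y5 on the
    second factor gives the claim. *)
Lemma dot_colon_swap (W : lmodType k) (E : H -> H -> W) x y : bilinear_fun E ->
  \sw_(x1, x2 <- x) \sw_(y1, y2 <- y) E (y1 ∶ x2) (x1 · y2) =
  \sw_(x1, x2 <- x) \sw_(y1, y2 <- y) E (y2 ∶ x1) (x2 · y1).
Proof.
move=> bE.
transitivity (\sw_(a, b <- y) \sw_(a1, a2 <- a) \sw_(x1, x2 <- x)
   \sw_(p, q <- a1) \sw_(r, t <- a2) E ((x1 · q) ▷ r) (((x2 · p) ◁ t) · b)).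
  rewrite sw_exchange; apply: eq_sw => a b.
  rewrite -(sol_dot_tlift (E := fun u v => E u (v · b))); last by multilin.
  by apply: eq_sw => a1 a2; rewrite sol_tlift ?sw_dot //; multilin.
rewrite sw_coassoc; [|by multilin..].
under eq_sw => a b do rewrite sw_exchange.
rewrite sw_exchange; apply: eq_sw => x1 x2.
under eq_sw => a b do rewrite sw_exchange.
rewrite sw_coassoc; [|by multilin..]; apply: eq_sw => p y'.
rewrite (colon_def ops) -(sw_lin (L := E^~ _)); last by multilin.
apply: eq_sw => q y''; rewrite sw_coassoc; [|by multilin..].
under eq_sw => r b do
    [rewrite (conv_inverseE (L := fun u => E _ u) _ _ (raK ops)); last by multilin].
by rewrite (sw_counitr _ (E := fun u => E ((x1 · q) ▷ u) _)); last by multilin.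
Qed.

Lemma counit_colon x y : counit (y ∶ x) = counit x * counit y.
Proof.
rewrite (colon_def ops) scalar_sw.
under eq_sw => a b do rewrite (counit_la ops) counit_dot /= mulrC.
rewrite (sw_counitr (W := k^o) _ (E := fun u => counit x * counit u)) //.
by multilin.
Qed.

(** Since y ∶ x = Σ (x · y1) ▷ y2, the coproduct is
    Σ ((x1 · y2) ▷ y3) ⊗ ((x2 · y1) ▷ y4) = Σ (y2 ∶ x1) ⊗ ((x2 · y1) ▷ y3), and
    [dot_colon_swap] restores the order of the factors. *)
Lemma sw_colon (W : lmodType k) (E : H -> H -> W) x y : bilinear_fun E ->
  sweedler (y ∶ x) E = \sw_(x1, x2 <- x) \sw_(y1, y2 <- y) E (y1 ∶ x2) (y2 ∶ x1).
Proof.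
move=> bE; rewrite {1}(colon_def ops).
transitivity (\sw_(a, b <- y) \sw_(x1, x2 <- x) \sw_(a1, a2 <- a) \sw_(b1, b2 <- b)
  E ((x1 · a2) ▷ b1) ((x2 · a1) ▷ b2)).
  rewrite /(sweedler _ E) linear_sw tlift_sw //; apply: eq_sw => a b.
  by rewrite -[LHS]/(sweedler _ E) sw_la // sw_dot // ; multilin.
rewrite sw_exchange.
transitivity (\sw_(a, b <- y) \sw_(x1, x2 <- x) \sw_(y1, y2 <- a) 
   E (y2 ∶ x1) ((x2 · y1) ▷ b)).
  rewrite [RHS]sw_exchange; apply: eq_sw => x1 x2.
  rewrite sw_coassoc; [|by multilin..].
  rewrite [RHS]sw_coassoc; [|by multilin..]; apply: eq_sw => a y'.
  rewrite -sw_coassoc; [|by multilin..]; apply: eq_sw => y2 b.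
  by rewrite (colon_def ops) -(sw_lin (L := E^~ _)); last by multilin.
under eq_sw => a b do [rewrite -(dot_colon_swap (E := fun u v => E u (v ▷ b))); last by multilin].
rewrite sw_exchange; apply: eq_sw => x1 x2.
rewrite sw_coassoc; [|by multilin..]; apply: eq_sw => y1 y2.
by rewrite (colon_def ops x1 y2) -(sw_lin (L := E _)); last by multilin.
Qed.

End Operations.

(** * The q-magma coalgebra axioms *)

Section QMagma.
Variables (k : fieldType) (H : coalgType k).
Variables (s : {linear (H ⊗ H)%type -> (H ⊗ H)%type}).
Variables (la ra dot colon : {linear (H ⊗ H)%type -> H}).

Local Notation "x ▷ y" := (la (x ⊗ y)).
Local Notation "x ◁ y" := (ra (x ⊗ y)).
Local Notation "x · y" := (dot (x ⊗ y)).
Local Notation "x ∶ y" := (colon (x ⊗ y)).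

Hypothesis ops : nondegenerate_ops s la ra dot colon.

Lemma q_magma_mapE (x y : H) : q_magma_map dot colon (x ⊗ y) =
  \sw_(x1, x2 <- x) \sw_(y1, y2 <- y) (y1 ∶ x2) ⊗ (x1 · y2).
Proof. by rewrite /q_magma_map tlift_tens //; multilin. Qed.

(** The two sides are the coproduct of the image and the image of the coproduct
    under the q-magma map; they differ in the inner factors only, and
    [dot_colon_swap] exchanges those. *)
Lemma dot_colon_swap4 x y :
  \sw_(x1, x2 <- x) \sw_(a, b <- x1) \sw_(c, d <- x2)
  \sw_(y1, y2 <- y) \sw_(p, q <- y1) \sw_(r, t <- y2)
    ((q ∶ c) ⊗ (a · t)) ⊗ ((p ∶ d) ⊗ (b · r)) =
  \sw_(x1, x2 <- x) \sw_(a, b <- x1) \sw_(c, d <- x2)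
  \sw_(y1, y2 <- y) \sw_(p, q <- y1) \sw_(r, t <- y2)
    ((r ∶ b) ⊗ (a · t)) ⊗ ((p ∶ d) ⊗ (c · q)).
Proof.
rewrite sw_coassoc4; [|by multilin..]; rewrite [RHS]sw_coassoc4; [|by multilin..].
apply: eq_sw => a x'; apply: eq_sw => X d.
under eq_sw => b c do [rewrite sw_coassoc4; [|by multilin..]].
under [RHS]eq_sw => b c do [rewrite sw_coassoc4; [|by multilin..]].
rewrite sw_exchange [RHS]sw_exchange; apply: eq_sw => p y'.
rewrite sw_exchange [RHS]sw_exchange; apply: eq_sw => Y t.
by apply: (dot_colon_swap ops (E := fun u v => (u ⊗ (a · t)) ⊗ ((p ∶ d) ⊗ v))); multilin.
Qed.

Lemma comul_q_magma_map (x y : H) :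
  @comul k (cop H ⊗ H)%type (q_magma_map dot colon (x ⊗ y)) =
  \sw_(x1, x2 <- x) \sw_(a, b <- x1) \sw_(c, d <- x2)
  \sw_(y1, y2 <- y) \sw_(p, q <- y1) \sw_(r, t <- y2)
    ((q ∶ c) ⊗ (a · t)) ⊗ ((p ∶ d) ⊗ (b · r)).
Proof.
rewrite q_magma_mapE linear_sw; apply: eq_sw => x1 x2.
under [RHS]eq_sw => a b do rewrite sw_exchange.
rewrite linear_sw [RHS]sw_exchange; apply: eq_sw => y1 y2.
rewrite comul_sw sw_tens; last by multilin.
rewrite sw_cop; last by multilin.
rewrite (sw_colon ops); last by multilin.
under eq_sw => p q do
  [under eq_sw => c d do [rewrite (sw_dot ops); last by multilin];
   rewrite sw_exchange].
by rewrite sw_exchange; apply: eq_sw => a b; rewrite sw_exchange.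
Qed.

Lemma q_magma_map_tens (x y : H) :
  sweedler (C := (H ⊗ cop H)%type) (x ⊗ y)
    (fun u v => q_magma_map dot colon u ⊗ q_magma_map dot colon v) =
  \sw_(x1, x2 <- x) \sw_(a, b <- x1) \sw_(c, d <- x2)
  \sw_(y1, y2 <- y) \sw_(p, q <- y1) \sw_(r, t <- y2)
    ((r ∶ b) ⊗ (a · t)) ⊗ ((p ∶ d) ⊗ (c · q)).
Proof.
have lM : linear (q_magma_map dot colon) by apply: tlift_linear; multilin.
rewrite sw_tens; last by multilin.
apply: eq_sw => x1 x2; rewrite sw_cop; last by multilin.
under [RHS]eq_sw => a b do rewrite sw_exchange.
rewrite [RHS]sw_exchange; apply: eq_sw => y1 y2.
rewrite !q_magma_mapE tens_swl; apply: eq_sw => a b.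
under [RHS]eq_sw => c d do rewrite sw_exchange.
rewrite tens_swl [RHS]sw_exchange; apply: eq_sw => r t.
by rewrite tens_swr; apply: eq_sw => c d; rewrite tens_swr.
Qed.

Lemma q_magma_map_morph :
   @coalg_morphism k (H ⊗ cop H)%type (cop H ⊗ H)%type (q_magma_map dot colon).
Proof.
have lM : linear (q_magma_map dot colon) by apply: tlift_linear; multilin.
split=> // t.
- rewrite -[RHS]/(sweedler t _).
  move: t; apply: tensor_ext; [by multilin|by multilin|] => x y.
  by rewrite comul_q_magma_map dot_colon_swap4 q_magma_map_tens.
- move: t; apply: (tensor_ext (W := k^o)) => [||x y].
  + by move=> a x y; rewrite lM linearP.
  + exact: linearP.
  rewrite [RHS]tensor_counitE q_magma_mapE scalar_sw.
  transitivity (sweedler (W := k^o) x (fun x1 x2 => sweedler (W := k^o) (y : H)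
    (fun y1 y2 => counit y1 *: (counit x2 *: (counit x1 * counit y2 : k^o))))).
    apply: (eq_sw (W := k^o)) => x1 x2; rewrite scalar_sw.
    apply: (eq_sw (W := k^o)) => y1 y2.
    rewrite [LHS]tensor_counitE [counit (_ ∶ _)](counit_colon ops).
    by rewrite (counit_dot ops) mulrA [counit x2 * _]mulrC -!mulrA.
  transitivity (sweedler (W := k^o) x
    (fun x1 x2 => counit x2 *: (counit x1 * counit (y : H) : k^o))).
    apply: (eq_sw (W := k^o)) => x1 x2.
    rewrite (sw_counitl (W := k^o) _ (E := fun u => counit x2 *: (counit x1 * counit u : k^o))) //.
    by move=> a u v; rewrite linearP mulrDr scalerDr; congr (_ + _);
      rewrite /= /GRing.scale /=; ring.
  apply: (sw_counitr (W := k^o) x (E := fun u => counit u * counit (y : H) : k^o)).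
  by move=> a u v; rewrite linearP /= mulrDl -mulrA.
Qed.

Lemma q_magma : q_magma_coalgebra dot colon.
Proof.
split; [exact: linearP|exact: linearP| | |exact: q_magma_map_morph].
- exact: counit_dot ops.
- by move=> x y; rewrite (counit_colon ops) mulrC.
Qed.

End QMagma.

(** * The q-cycle identities from the braid equation *)

Section QCycle.
Variables (k : fieldType) (H : coalgType k).
Variables (s : {linear (H ⊗ H)%type -> (H ⊗ H)%type}).
Variables (la ra dot colon : {linear (H ⊗ H)%type -> H}).

Local Notation "x ▷ y" := (la (x ⊗ y)).
Local Notation "x ◁ y" := (ra (x ⊗ y)).
Local Notation "x · y" := (dot (x ⊗ y)).
Local Notation "x ∶ y" := (colon (x ⊗ y)).

Hypothesis ops : nondegenerate_ops s la ra dot colon.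
Hypothesis braid : braid_equation s.

Lemma map12_tens x y z : map12 s (x ⊗ y ⊗ z) = s (x ⊗ y) ⊗ z.
Proof. exact: tmapE. Qed.

(** On pure tensors the reassociations in [map23] disappear. *)
Lemma map23_tens (x y z : H) :
  map23 s (x ⊗ y ⊗ z) = tlift (fun u v => x ⊗ u ⊗ v) (s (y ⊗ z)).
Proof.
rewrite /map23 /= tassocE tmapE /= [s (y ⊗ z) in LHS]tensor_sumE.
rewrite linear_sum linear_sum; apply: eq_bigr => -[u v] _.
by rewrite /= tassocIE.
Qed.

Lemma tforml_sol x y : tforml counit (s (x ⊗ y)) = x ◁ y.
Proof.
rewrite (sol_def ops) linear_sw.
under eq_sw => x1 x2.
  rewrite linear_sw.
  under eq_sw => y1 y2 do rewrite /= tformlE (counit_la ops) -scalerA.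
  rewrite (sw_lin (L := fun u => counit x1 *: u)); last by multilin.
  rewrite (sw_counitl _ (E := fun u => x2 ◁ u)); last by multilin.
  over.
by rewrite (sw_counitl _ (E := fun u => u ◁ y)); last by multilin.
Qed.

Lemma tformr_sol x y : tformr counit (s (x ⊗ y)) = x ▷ y.
Proof.
rewrite (sol_def ops) linear_sw.
under eq_sw => x1 x2.
  rewrite linear_sw.
  under eq_sw => y1 y2 do rewrite /= tformrE (counit_ra ops) -scalerA.
  rewrite (sw_lin (L := fun u => counit x2 *: u)); last by multilin.
  rewrite (sw_counitr _ (E := fun u => x1 ▷ u)); last by multilin.
  over.
by rewrite (sw_counitr _ (E := fun u => u ▷ y)); last by multilin.
Qed.

Lemma map12_linear : linear (map12 s).
Proof. exact: linearP. Qed.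

Lemma map23_linear : linear (map23 s).
Proof. by move=> a x y; rewrite /map23 /= !linearP. Qed.

Lemma tforml_map23 x y z :
  tforml counit (map23 s (x ⊗ y ⊗ z)) = counit x *: (y ◁ z).
Proof.
rewrite map23_tens linear_tlift /= -tforml_sol /tforml linear_tlift.
apply: eq_tlift => u v /=.
by rewrite -/(tforml _ _) tformlE /= tensor_counitE scalerA.
Qed.

Lemma tformr_map23 x y z :
  tformr counit (map23 s (x ⊗ y ⊗ z)) = x ⊗ (y ▷ z).
Proof.
rewrite map23_tens linear_tlift /= -tformr_sol /tformr linear_tlift.
apply: eq_tlift => u v /=.
by rewrite -/(tformr _ _) tformrE /= linearZ.
Qed.

Lemma tforml_map12 w : tforml counit (map12 s w) = tforml counit w.
Proof.
move: w; apply: tensor_ext => [||t z]; [by multilin|by multilin|].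
by rewrite [map12 s _]tmapE !tformlE /=; case: (sol_morph ops) => _ _ ->.
Qed.

Lemma tformr_map12 w : tformr counit (map12 s w) = s (tformr counit w).
Proof.
move: w; apply: tensor_ext => [||t z]; [by multilin|by multilin|].
by rewrite [map12 s _]tmapE !tformrE /= linearZ.
Qed.

(** The third leg of the braid equation. *)
Lemma ra_braid x y z :
  (x ◁ y) ◁ z = tlift (fun y z => (x ◁ y) ◁ z) (s (y ⊗ z)).
Proof.
have l23 := map23_linear.
have T23 t c : tforml counit (map23 s (t ⊗ c)) = tforml counit t ◁ c.
  move: t; apply: tensor_ext => [||u v]; [by multilin|by multilin|].
  by rewrite tforml_map23 tformlE tens_linearZl linearZ.
have := congr1 (tforml counit) (braid (x ⊗ y ⊗ z)).
rewrite /= tforml_map12 map12_tens T23 tforml_sol => ->.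
rewrite map23_tens (tlift_lin _ _ map12_linear) (tlift_lin _ _ l23) linear_tlift.
by apply: eq_tlift => u v; rewrite /= map12_tens T23 tforml_sol.
Qed.

Definition ra2 (x : H) : H ⊗ H -> H := tlift (fun y z => (x ◁ y) ◁ z).

(** The inverse of [ra2], hence the reversed order of y and z. *)
Definition dot2 (x : H) : H ⊗ H -> H := tlift (fun y z => (x · z) · y).

Lemma bilinear_ra2 : bilinear_fun ra2.
Proof. by rewrite /ra2; multilin. Qed.

Lemma bilinear_dot2 : bilinear_fun dot2.
Proof. by rewrite /dot2; multilin. Qed.

Lemma ra2_tens x y z : ra2 x (y ⊗ z) = (x ◁ y) ◁ z.
Proof. by rewrite /ra2 tlift_tens //; multilin. Qed.

Lemma dot2_tens x y z : dot2 x (y ⊗ z) = (x · z) · y.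
Proof. by rewrite /dot2 tlift_tens //; multilin. Qed.

Lemma conv_inverse_ra2 : conv_inverse ra2 dot2.
Proof.
by apply: (conv_inverse_tensor _ _ _ _ (dotK ops) (dotK ops)); multilin.
Qed.

Lemma conv_inverse_dot2 : conv_inverse dot2 ra2.
Proof.
by apply: (conv_inverse_tensor_swap _ _ _ _ (raK ops) (raK ops)); multilin.
Qed.

(** By [ra_braid] the action [ra2] is invariant under s; its inverse then is too. *)
Lemma dot2_sol x t : dot2 x (s t) = dot2 x t.
Proof.
have bF := bilinear_ra2; have bP := bilinear_dot2.
have sF u c : ra2 u (s c) = ra2 u c.
  move: c; apply: tensor_ext => [||y z]; [by multilin|by multilin|].
  by rewrite ra2_tens ra_braid.
have bPs : bilinear_fun (fun u c => dot2 u (s c)) by split=> [v|u]; multilin.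
have bFs : bilinear_fun (fun u c => ra2 u (s c)) by split=> [v|u]; multilin.
pose id : {linear H -> H} := idfun.
have := conv_inverse_intertwine (phi := id) bF bP bFs bPs conv_inverse_ra2
  (conv_inverse_pullback bP bF (sol_morph ops) conv_inverse_dot2).
by move=> e; symmetry; apply: e => u c; rewrite sF.
Qed.

(** [dot2_sol] on the tensor Σ (y · z1) ⊗ z2, whose image under s is
    Σ (z ∶ y2) ⊗ y1. *)
Lemma dot_dot x y z :
  \sw_(y1, y2 <- y) (x · y1) · (z ∶ y2) = \sw_(z1, z2 <- z) (x · z2) · (y · z1).
Proof.
have bP := bilinear_dot2.
transitivity (\sw_(z1, z2 <- z) dot2 x (s ((y · z1) ⊗ z2))).
  rewrite (sol_dot_tlift ops (E := fun y z => (x · z) · y)) //; last by multilin.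
under eq_sw => z1 z2 do rewrite dot2_sol.
by apply: eq_sw => z1 z2; rewrite /dot2 tlift_tens //; multilin.
Qed.

(** The image of x ⊗ t under the colinear extension Σ dot2 x t1 ⊗ t2 of [dot2], with
    t2 in the last two legs.  It is made for the braid equation: s on the last
    two legs acts as s on t, and s on the first two legs meets a tensor
    Σ (a · y1) ⊗ y2 on which its value is known. *)
Definition dot2_graph (x : H) (t : H ⊗ H) : (H ⊗ H) ⊗ H :=
  \sw_(t1, t2 <- t) tlift (fun y z => dot2 x t1 ⊗ y ⊗ z) t2.

Lemma map23_dot2_graph x t : map23 s (dot2_graph x t) = dot2_graph x (s t).
Proof.
have bP := bilinear_dot2.
have E23 u w : map23 s (tlift (fun y z => u ⊗ y ⊗ z) w) =
    tlift (fun y z => u ⊗ y ⊗ z) (s w).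
  have l23 := map23_linear.
  move: w; apply: tensor_ext => [||y z]; [by multilin|by multilin|].
  by rewrite tlift_tens ?map23_tens //; multilin.
rewrite /dot2_graph (sw_morph (f := s)); [|exact: sol_morph ops|by multilin].
rewrite -(sw_lin _ _ map23_linear); apply: eq_sw => t1 t2.
by rewrite E23 dot2_sol.
Qed.

(** The first two legs of s23 s12 applied to [dot2_graph], see
    [colon_graphE]. *)
Definition colon_graph (x : H) : H ⊗ H -> H ⊗ H :=
  tlift (fun y z => \sw_(x1, x2 <- x) \sw_(z1, z2 <- z)
    (y ∶ (x2 · z1)) ⊗ (z2 ∶ x1)).

Lemma colon_graphE x t :
  colon_graph x t = tformr counit (map23 s (map12 s (dot2_graph x t))).
Proof.
have bP := bilinear_dot2.
have l23 := map23_linear; have l12 := map12_linear.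
move: t; apply: tensor_ext => [|| y z].
- by rewrite /colon_graph; multilin.
- by rewrite /dot2_graph; multilin.
rewrite /colon_graph tlift_tens; last by multilin.
rewrite /dot2_graph sw_tens; last by multilin.
transitivity (\sw_(b, c <- z) \sw_(x1, x2 <- x) \sw_(p, q <- b)
   ((y ∶ (x2 · p)) ⊗ ((x1 · q) ▷ c))).
  rewrite [RHS]sw_exchange; apply: eq_sw => x1 x2.
  rewrite sw_coassoc; [|by multilin..]; apply: eq_sw => p c.
  by rewrite (colon_def ops x1) tens_swr.
rewrite [in RHS]sw_exchange -(sw_lin (L := fun w => tformr counit (map23 s (map12 s w))));
  last by multilin.
apply: eq_sw => b c; rewrite -(sw_lin (L := fun w => tformr counit (map23 s (map12 s w))));
  last by multilin.
rewrite -(sw_dot ops (E := fun u v => (y ∶ v) ⊗ (u ▷ c))); last by multilin.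
rewrite -(sol_dot_tlift ops (E := fun u v => u ⊗ (v ▷ c))); last by multilin.
apply: eq_sw => y1 y2; rewrite tlift_tens; last by multilin.
rewrite map12_tens /dot2 tlift_tens; last by multilin.
have E23 w : tformr counit (map23 s (w ⊗ c)) = tlift (fun u v => u ⊗ (v ▷ c)) w.
  move: w; apply: tensor_ext => [||u v]; [by multilin|by multilin|].
  by rewrite tformr_map23 tlift_tens //; multilin.
by rewrite E23.
Qed.

(** The first two legs of the braid equation on [dot2_graph]: the outer map on
    one side is s on these legs, and on the other side s on the last two legs moves
    inside by [map23_dot2_graph]. *)
Lemma sol_colon_graph x t : s (colon_graph x t) = colon_graph x (s t).
Proof.
rewrite !colon_graphE -tformr_map12 -map23_dot2_graph.
by congr (tformr _ _); have /= <- := braid (dot2_graph x t).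
Qed.

(* The left-hand side of the second q-cycle identity, with b, a, z for its x, z, y. *)
Let Q b a z := \sw_(z1, z2 <- z) (b · z1) ∶ (a · z2).

Let Q_linear3 x y : linear (fun z => Q x y z).
Proof. by rewrite /Q; multilin. Qed.

Let Q_linear2 x z : linear (fun y => Q x y z).
Proof. by rewrite /Q; multilin. Qed.

Lemma colon_graph_tens a b z : colon_graph a (b ⊗ z) =
  \sw_(x1, x2 <- a) \sw_(z1, z2 <- z) (b ∶ (x2 · z1)) ⊗ (z2 ∶ x1).
Proof. by rewrite /colon_graph tlift_tens //; multilin. Qed.

(** [sol_colon_graph] on the tensor Σ (b · z1) ⊗ z2. *)
Lemma sol_colon_graph_dot a b z :
  \sw_(z1, z2 <- z) \sw_(a1, a2 <- a) s (Q b a2 z1 ⊗ (z2 ∶ a1)) =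
  \sw_(b1, b2 <- b) colon_graph a ((z ∶ b2) ⊗ b1).
Proof.
under [RHS]eq_sw => b1 b2 do rewrite colon_graph_tens.
rewrite -(sol_dot_tlift ops (E := fun u v => \sw_(x1, x2 <- a)
  \sw_(z1, z2 <- v) (u ∶ (x2 · z1)) ⊗ (z2 ∶ x1))); last by multilin.
rewrite -/(colon_graph a).
under [RHS]eq_sw => z1 z2 do rewrite -sol_colon_graph colon_graph_tens.
rewrite sw_exchange.
transitivity (\sw_(a1, a2 <- a) \sw_(z1, z2 <- z) \sw_(p, q <- z2)
   s (((b · z1) ∶ (a2 · p)) ⊗ (q ∶ a1))).
  apply: eq_sw => a1 a2; rewrite -sw_coassoc; [|by multilin..].
  apply: eq_sw => z1 z2; rewrite /Q tens_swl linear_sw //.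
rewrite sw_exchange; apply: eq_sw => z1 z2; rewrite linear_sw.
by apply: eq_sw => a1 a2; rewrite linear_sw.
Qed.

(** The second component of [sol_colon_graph_dot]. *)
Lemma dot_colon_ra a b z :
  \sw_(z1, z2 <- z) \sw_(a1, a2 <- a) Q b a2 z1 ◁ (z2 ∶ a1) = counit z *: (b ∶ a).
Proof.
transitivity (tforml counit (\sw_(z1, z2 <- z) \sw_(a1, a2 <- a) s (Q b a2 z1 ⊗ (z2 ∶ a1)))).
  rewrite linear_sw; apply: eq_sw => z1 z2; rewrite linear_sw.
  by apply: eq_sw => a1 a2; rewrite /= tforml_sol.
rewrite sol_colon_graph_dot linear_sw.
transitivity (\sw_(b1, b2 <- b) counit b2 *: (counit z *: (b1 ∶ a))).
  apply: eq_sw => b1 b2; rewrite colon_graph_tens linear_sw.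
  transitivity (\sw_(a1, a2 <- a) \sw_(p, q <- b1)
      counit p *: (counit a2 *: (counit b2 *: (counit z *: (q ∶ a1))))).
    apply: eq_sw => a1 a2; rewrite linear_sw; apply: eq_sw => p q.
    rewrite /= tformlE !(counit_colon ops) (counit_dot ops) !scalerA.
    by congr (_ *: _); ring.
  under eq_sw => a1 a2 do [rewrite sw_counitl; last by multilin].
  by rewrite sw_counitr //; multilin.
by rewrite sw_counitr //; multilin.
Qed.

(** In [dot_colon_ra] the action of z2 ∶ a1 is undone by acting with · on both
    sides, the coproduct of z ∶ a providing the second copy. *)
Lemma dot_colon x y z :
  \sw_(y1, y2 <- y) (x · y1) ∶ (z · y2) = \sw_(z1, z2 <- z) (x ∶ z2) · (y ∶ z1).
Proof.
rewrite -/(Q x z y); symmetry.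
transitivity (\sw_(z1, z2 <- z) \sw_(y1, y2 <- y) \sw_(p, q <- z2) \sw_(u, v <- y1)
  (Q x q u ◁ (v ∶ p)) · (y2 ∶ z1)).
  apply: eq_sw => z1 z2.
  rewrite -(sw_counitl y (E := fun w => (x ∶ z2) · (w ∶ z1))); last by multilin.
  apply: eq_sw => y1 y2.
  rewrite -[LHS](linear_funZ _ _ (f := fun w => w · (y2 ∶ z1))); last by multilin.
  rewrite -dot_colon_ra sw_exchange -(sw_lin (L := fun w => w · (y2 ∶ z1))); last by multilin.
  apply: eq_sw => a1 a2.
  by rewrite -(sw_lin (L := fun w => w · (y2 ∶ z1))); last by multilin.
transitivity (\sw_(z1, z2 <- z) \sw_(y1, y2 <- y) \sw_(c1, c2 <- (y2 ∶ z1))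
  (Q x z2 y1 ◁ c1) · c2).
  transitivity (\sw_(z1, z2 <- z) \sw_(y1, y2 <- y) \sw_(p, q <- z1) \sw_(u, v <- y2)
    (Q x z2 y1 ◁ (u ∶ q)) · (v ∶ p)); last first.
    apply: eq_sw => z1 z2; apply: eq_sw => y1 y2.
    by rewrite (sw_colon ops) //; multilin.
  rewrite sw_exchange [RHS]sw_exchange.
  under eq_sw => d1 d2 do
    [under eq_sw => c1 c2 do rewrite sw_exchange; rewrite sw_exchange].
  under [RHS]eq_sw => d1 d2 do
    [under eq_sw => c1 c2 do rewrite sw_exchange; rewrite sw_exchange].
  rewrite sw_coassoc; [|by multilin..]; apply: eq_sw => u y'; apply: eq_sw => v y2.
  by rewrite [RHS]sw_coassoc //; multilin.
under eq_sw => z1 z2 do under eq_sw => y1 y2 do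
  [rewrite (raK ops _ (y2 ∶ z1)) (counit_colon ops) mulrC -scalerA].
under eq_sw => z1 z2.
  rewrite sw_counitr; last by multilin.
  over.
by rewrite sw_counitl //; multilin.
Qed.

(** The first component of [sol_colon_graph_dot].  There Q can be rewritten by
    [dot_colon], after which [sol_dot] evaluates s. *)
Lemma colon_colon x y z :
  \sw_(y1, y2 <- y) (x ∶ y1) ∶ (z ∶ y2) = \sw_(z1, z2 <- z) (x ∶ z2) ∶ (y · z1).
Proof.
transitivity (tformr counit (\sw_(x1, x2 <- x) \sw_(y1, y2 <- y) s (Q z y2 x1 ⊗ (x2 ∶ y1)))).
  transitivity (tformr counit (\sw_(a, v <- y) \sw_(c1, c2 <- x ∶ a)
      s (((z ∶ v) · c1) ⊗ c2))).
    rewrite linear_sw; apply: eq_sw => a v; rewrite (sol_dot ops) linear_sw.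
    under eq_sw => w1 w2 do rewrite /= tformrE.
    by rewrite sw_counitl; last by multilin.
  congr (tformr _ _); rewrite [RHS]sw_exchange.
  transitivity (\sw_(a, v <- y) \sw_(a1, a2 <- a) \sw_(x1, x2 <- x)
      s (((z ∶ v) · (x1 ∶ a2)) ⊗ (x2 ∶ a1))).
    by apply: eq_sw => a v; rewrite (sw_colon ops) //; multilin.
  rewrite sw_coassoc; [|by multilin..]; apply: eq_sw => a1 y2.
  rewrite sw_exchange; apply: eq_sw => x1 x2.
  by rewrite /Q dot_colon tens_swl linear_sw.
rewrite sol_colon_graph_dot linear_sw; apply: eq_sw => z1 z2.
rewrite colon_graph_tens linear_sw.
rewrite -(sw_counitl y (E := fun w => (x ∶ z2) ∶ (w · z1))); last by multilin.
apply: eq_sw => y1 y2; rewrite linear_sw.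
under eq_sw => p q do rewrite /= tformrE /= (counit_colon ops) mulrC -scalerA.
rewrite (sw_counitr z1 (E := fun p => _ *: ((x ∶ z2) ∶ (y2 · p)))) ?linearZ //.
by multilin.
Qed.

End QCycle.

(** * Construction of the operations *)

Section Solution.
Variables (k : fieldType) (H : coalgType k).
Variables (s : {linear (H ⊗ H)%type -> (H ⊗ H)%type}).
Hypothesis s_morph : coalg_morphism s.
Hypothesis s_nondeg : left_nondegenerate s.

Definition lact : {linear (H ⊗ H)%type -> H} := tformr counit \o s.
Definition ract : {linear (H ⊗ H)%type -> H} := tforml counit \o s.

Lemma coalg_morphism_lact : coalg_morphism lact.
Proof. exact: (coalg_morphism_comp (coalg_morphism_tformr H H) s_morph). Qed.

Lemma coalg_morphism_ract : coalg_morphism ract.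
Proof. exact: (coalg_morphism_comp (coalg_morphism_tforml H H) s_morph). Qed.

Lemma sol_lact_ract t : s t = \sw_(t1, t2 <- t) lact t1 ⊗ ract t2.
Proof.
rewrite -[LHS]tformr_tforml_comul; rewrite -[LHS]/(sweedler (s t) _).
by rewrite (sw_morph _ s_morph) //; multilin.
Qed.

Lemma sol_ract_lact t : s t = \sw_(t1, t2 <- t) lact t2 ⊗ ract t1.
Proof.
have tK (u : H ⊗ H) : tswap (tswap u) = u.
  by move: u; apply: tensor_ext => [||x y]; rewrite ?tswapE //; multilin.
rewrite -[LHS]tK -(tforml_tformr_comul (s t)) -[tmap _ _ _]/(sweedler (s t) _).
rewrite (sw_morph _ s_morph); last by multilin.
by rewrite linear_sw; apply: eq_sw => t1 t2; rewrite /= tswapE.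
Qed.

Lemma G_s_linear : linear (G_s s).
Proof. by apply: tlift_linear; rewrite -[s_2 s]/(ract : _ -> _); multilin. Qed.

Lemma inv_G_s_linear : linear (inv_map (G_s s)).
Proof.
move=> a x y; apply: (bij_inj s_nondeg).
by rewrite G_s_linear !(inv_mapKV s_nondeg).
Qed.

Definition sol_dot_op : {linear (H ⊗ H)%type -> H} :=
  tformr counit \o linmap inv_G_s_linear.

Lemma G_s_tens x y : G_s s (x ⊗ y) = \sw_(y1, y2 <- y) ract (x ⊗ y1) ⊗ y2.
Proof.
by rewrite /G_s tlift_tens // -[s_2 s]/(ract : _ -> _); multilin.
Qed.

(** G_s is colinear for the coaction of H on the right-hand factor, hence so is its
    inverse; a colinear map into H ⊗ H is determined by its composite with the
    counit of that factor, here the operation ·. *)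
Lemma inv_G_s_tens x y :
  inv_map (G_s s) (x ⊗ y) = \sw_(y1, y2 <- y) sol_dot_op (x ⊗ y1) ⊗ y2.
Proof.
(* The coaction on the right-hand factor, for which G_s and its inverse are colinear. *)
pose rho := tlift (fun x y : H => \sw_(y1, y2 <- y) x ⊗ y1 ⊗ y2).
have lG := G_s_linear; have lJ := inv_G_s_linear.
have lr : linear rho by rewrite /rho; multilin.
have rhoE u v : rho (u ⊗ v) = \sw_(v1, v2 <- v) u ⊗ v1 ⊗ v2.
  by rewrite /rho tlift_tens //; multilin.
have rhoG t : rho (G_s s t) = tmap (linmap lG) idfun (rho t).
  move: t; apply: tensor_ext => [||u v]; [by multilin|by multilin|].
  rewrite G_s_tens rhoE linear_sw -sw_lin //.
  under eq_sw => v1 v2 do rewrite rhoE.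
  rewrite -sw_coassoc; [|by multilin..]; apply: eq_sw => v1 v2.
  by rewrite -tens_swl -G_s_tens; symmetry; exact: (tmapE (linmap lG) idfun).
have rhoK t : tmap (tformr counit) idfun (rho t) = t.
  move: t; apply: tensor_ext => [||u v]; [by multilin|by multilin|].
  rewrite rhoE linear_sw.
  under eq_sw => v1 v2 do rewrite /= tmapE /= tformrE tens_linearZl.
  by rewrite sw_counitl //; multilin.
have rhoJ t : rho (inv_map (G_s s) t) = tmap (linmap lJ) idfun (rho t).
  rewrite -{2}[t](inv_mapKV s_nondeg) rhoG.
  move: (rho _); apply: tensor_ext => [||u v]; [by multilin|by multilin|].
  by rewrite !tmapE /= inv_mapK.
rewrite -[LHS]rhoK rhoJ rhoE !linear_sw; apply: eq_sw => y1 y2.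
rewrite (_ : _ ( _ ⊗ _) = linmap lJ (x ⊗ y1) ⊗ y2); last exact: (tmapE (linmap lJ) idfun).
exact: (tmapE (tformr counit) idfun).
Qed.

Lemma lact_tens x y : comul (lact (x ⊗ y)) =
  \sw_(x1, x2 <- x) \sw_(y1, y2 <- y) lact (x1 ⊗ y1) ⊗ lact (x2 ⊗ y2).
Proof.
have [_ -> _] := coalg_morphism_lact.
by rewrite -[LHS]/(sweedler (x ⊗ y) _) sw_tens //; multilin.
Qed.

Lemma ract_tens x y : comul (ract (x ⊗ y)) =
  \sw_(x1, x2 <- x) \sw_(y1, y2 <- y) ract (x1 ⊗ y1) ⊗ ract (x2 ⊗ y2).
Proof.
have [_ -> _] := coalg_morphism_ract.
by rewrite -[LHS]/(sweedler (x ⊗ y) _) sw_tens //; multilin.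
Qed.

Lemma colon_op_linear : linear (colon_op s).
Proof.
apply: tlift_linear; rewrite -[s_1 s]/(lact : _ -> _).
rewrite -[dot_op s]/(sol_dot_op : _ -> _); multilin.
Qed.

Definition sol_colon_op : {linear (H ⊗ H)%type -> H} := linmap colon_op_linear.

Lemma solution_ops :
  nondegenerate_ops s lact ract sol_dot_op sol_colon_op.
Proof.
have lG := G_s_linear; have lJ := inv_G_s_linear.
have raE t : ract t = tformr counit (G_s s t).
  move: t; apply: tensor_ext => [||u v]; [by multilin|by multilin|].
  rewrite G_s_tens linear_sw.
  under eq_sw => v1 v2 do rewrite /= tformrE.
  by rewrite (sw_counitr v (E := fun v => ract (u ⊗ v))) //; multilin.
split.
- exact: lact_tens.
- exact: ract_tens.
- by move=> x y; have [_ _ ->] := coalg_morphism_lact; exact: tensor_counitE.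
- by move=> x y; have [_ _ ->] := coalg_morphism_ract; exact: tensor_counitE.
- exact: s_morph.
- by move=> x y; rewrite sol_lact_ract sw_tens //; multilin.
- by move=> x y; rewrite sol_ract_lact sw_tens //; multilin.
- move=> x y; rewrite sw_lin; last by multilin.
  by rewrite -inv_G_s_tens raE (inv_mapKV s_nondeg) tformrE.
- move=> x y; rewrite sw_lin; last by multilin.
  by rewrite -G_s_tens /= (inv_mapK s_nondeg) tformrE.
- move=> x y; rewrite /= /colon_op tlift_tens //.
  rewrite -[s_1 s]/(lact : _ -> _) -[dot_op s]/(sol_dot_op : _ -> _); multilin.
Qed.

(** The map in question is the inverse of G_s. *)
Lemma left_regular_dot_op : left_regular (dot_op s).
Proof.
have E : inv_map (G_s s) =1
    tlift (fun x y => \sw_(y1, y2 <- y) dot_op s (x ⊗ y1) ⊗ y2).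
  rewrite -[dot_op s]/(sol_dot_op : _ -> _).
  apply: tensor_ext; [exact: inv_G_s_linear|by multilin|] => x y.
  by rewrite inv_G_s_tens tlift_tens //; multilin.
apply: eq_bij E; exists (G_s s); [exact: inv_mapKV|exact: inv_mapK].
Qed.

End Solution.

(** * Compatibility with the product of a Hopf algebra *)

Section HopfSweedler.
Variables (k : fieldType) (H : hopfAlgType k).

Lemma sw_mul (W : lmodType k) (E : H -> H -> W) (x y : H) : bilinear_fun E ->
  sweedler (x * y) E = \sw_(x1, x2 <- x) \sw_(y1, y2 <- y) E (x1 * y1) (x2 * y2).
Proof. exact: sw_comul (comulM x y). Qed.

Lemma sw_one (W : lmodType k) (E : H -> H -> W) : bilinear_fun E ->
  sweedler (1 : H) E = E 1 1.
Proof. by move=> bE; rewrite /sweedler comul1 tlift_tens. Qed.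

Lemma mul_map_linear : linear (@mul_map k H).
Proof. by apply: tlift_linear; multilin. Qed.

HB.instance Definition _ :=
  GRing.isLinear.Build k (H ⊗ H)%type H _ (@mul_map k H) mul_map_linear.

Lemma mul_map_tens (x y : H) : mul_map (x ⊗ y) = x * y.
Proof. by rewrite /mul_map tlift_tens //; multilin. Qed.

Lemma coalg_morphism_mul : coalg_morphism (@mul_map k H).
Proof.
have lm := mul_map_linear.
split=> // t.
- rewrite -[RHS]/(sweedler t _).
  move: t; apply: tensor_ext; [by multilin|by multilin|] => x y.
  rewrite mul_map_tens comulM sw_tens; last by multilin.
  by apply: eq_sw => x1 x2; apply: eq_sw => y1 y2; rewrite !mul_map_tens.
- move: t; apply: (tensor_ext (W := k^o)) => [||x y].
  + by move=> a x y; rewrite lm linearP.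
  + exact: linearP.
  by rewrite mul_map_tens counitM [RHS]tensor_counitE.
Qed.

End HopfSweedler.

Section HopfBrace.
Variables (k : fieldType) (H : hopfAlgType k).
Variables (s : {linear (H ⊗ H)%type -> (H ⊗ H)%type}).
Variables (la ra dot colon : {linear (H ⊗ H)%type -> H}).

Local Notation "x ▷ y" := (la (x ⊗ y)).
Local Notation "x ◁ y" := (ra (x ⊗ y)).
Local Notation "x · y" := (dot (x ⊗ y)).
Local Notation "x ∶ y" := (colon (x ⊗ y)).

Hypothesis ops : nondegenerate_ops s la ra dot colon.

(** Every x ⊗ y equals Σ ((x ◁ y1) · y2) ⊗ y3, so the tensors Σ (a · b1) ⊗ b2
    span H ⊗ H. *)
Lemma dot_surj (W : lmodType k) (f g : H -> H -> W) :
  bilinear_fun f -> bilinear_fun g ->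
  (forall x y, \sw_(y1, y2 <- y) f (x · y1) y2 = \sw_(y1, y2 <- y) g (x · y1) y2) ->
  forall x y, f x y = g x y.
Proof.
move=> bf bg fg x y.
have br : bilinear_fun (fun x y => x ◁ y) by multilin.
have bd : bilinear_fun (fun x y => x · y) by multilin.
rewrite -(conv_inverse_tail x y bd br (raK ops) bf).
rewrite -(conv_inverse_tail x y bd br (raK ops) bg).
by apply: eq_sw => a b; apply: fg.
Qed.

Lemma ra_dot_1r : (forall x, x ◁ 1 = x) <-> (forall x, x · 1 = x).
Proof.
have e1 x : (x · 1) ◁ 1 = x.
  by have := dotK ops x 1; rewrite sw_one ?counit1 ?scale1r //; multilin.
have e2 x : (x ◁ 1) · 1 = x.
  by have := raK ops x 1; rewrite sw_one ?counit1 ?scale1r //; multilin.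
by split=> e x; [rewrite -{2}[x]e1 e|rewrite -{2}[x]e2 e].
Qed.

Lemma ra_dot_1l : (forall y, 1 ◁ y = counit y *: 1) <-> (forall y, 1 · y = counit y *: 1).
Proof.
split=> e y.
- rewrite -(raK ops 1 y); under eq_sw => a b do rewrite e tens_linearZl linearZ /=.
  by rewrite sw_counitl //; multilin.
- rewrite -(dotK ops 1 y); under eq_sw => a b do rewrite e tens_linearZl linearZ /=.
  by rewrite sw_counitl //; multilin.
Qed.

(** Both sides describe the same pair of actions of H ⊗ H on H: pulled back along
    the multiplication, and composed from two actions of H. *)
Lemma ra_dot_mulr : (forall x y z, x ◁ (y * z) = (x ◁ y) ◁ z) <->
  (forall x y z, x · (y * z) = (x · z) · y).
Proof.
have lm := @mul_map_linear k H; have mM := coalg_morphism_mul H.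
have b1 := @bilinear_ra2 _ _ ra; have b2 := @bilinear_dot2 _ _ dot.
have br : bilinear_fun (fun x y => x ◁ y) by multilin.
have bd : bilinear_fun (fun x y => x · y) by multilin.
have br' : bilinear_fun (fun x t => x ◁ mul_map t) by multilin.
have bd' : bilinear_fun (fun x t => x · mul_map t) by multilin.
have iF := conv_inverse_pullback br bd mM (dotK ops).
have iP := conv_inverse_pullback bd br mM (raK ops).
pose id : {linear H -> H} := idfun.
split=> e x y z.
- rewrite -mul_map_tens -dot2_tens.
  apply: (conv_inverse_intertwine (phi := id) br' bd' b1 b2 iF (conv_inverse_dot2 ops)).
  move=> u; apply: tensor_ext => [||v w]; [by multilin|by multilin|].
  by rewrite mul_map_tens e /= ra2_tens.
- rewrite -mul_map_tens -ra2_tens.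
  apply: (conv_inverse_intertwine (phi := id) bd' br' b2 b1 iP (conv_inverse_ra2 ops)).
  move=> u; apply: tensor_ext => [||v w]; [by multilin|by multilin|].
  by rewrite mul_map_tens e /= dot2_tens.
Qed.

(** The action of H on H ⊗ H for which the multiplication is equivariant exactly
    when the matched pair axiom on (x * y) ◁ z holds; [dot_pair] is its inverse and
    plays the same role for (x * y) · z. *)
Definition ra_pair (t : H ⊗ H) (z : H) : H ⊗ H :=
  tlift (fun x y => \sw_(y1, y2 <- y) \sw_(z1, z2 <- z) (x ◁ (y1 ▷ z1)) ⊗ (y2 ◁ z2)) t.

Definition dot_pair (t : H ⊗ H) (z : H) : H ⊗ H :=
  tlift (fun x y => \sw_(z1, z2 <- z) \sw_(y1, y2 <- y) (x · (z1 ∶ y2)) ⊗ (y1 · z2)) t.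

Lemma bilinear_ra_pair : bilinear_fun ra_pair.
Proof. by rewrite /ra_pair; multilin. Qed.

Lemma bilinear_dot_pair : bilinear_fun dot_pair.
Proof. by rewrite /dot_pair; multilin. Qed.

Lemma ra_pair_sol x y z :
  ra_pair (x ⊗ y) z = tlift (fun u v => (x ◁ u) ⊗ v) (s (y ⊗ z)).
Proof.
rewrite /ra_pair tlift_tens; last by multilin.
by rewrite (sol_tlift ops) //; multilin.
Qed.

(** [sol_dot] with an action on a further factor: in this parametrization
    [ra_pair] amounts to the action of z ∶ y alone. *)
Lemma ra_pair_dot x y z : \sw_(z1, z2 <- z) ra_pair (x ⊗ (y · z1)) z2 =
  \sw_(y1, y2 <- y) (x ◁ (z ∶ y2)) ⊗ y1.
Proof.
under eq_sw => z1 z2 do rewrite ra_pair_sol.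
by rewrite (sol_dot_tlift ops) //; multilin.
Qed.

Lemma dot_pair_tens x y z : dot_pair (x ⊗ y) z =
  \sw_(z1, z2 <- z) \sw_(y1, y2 <- y) (x · (z1 ∶ y2)) ⊗ (y1 · z2).
Proof. by rewrite /dot_pair tlift_tens //; multilin. Qed.

(** The factors z1 ∶ y3 and z2 ∶ y2 that act on x form the coproduct of a single
    element, so that · and ◁ cancel. *)
Lemma conv_inverse_ra_pair : conv_inverse ra_pair dot_pair.
Proof.
have bF := bilinear_ra_pair; have bP := bilinear_dot_pair.
move=> t z; move: t; apply: tensor_ext; [by multilin|by multilin|] => x y.
transitivity (\sw_(a, b <- z) \sw_(p, q <- a) \sw_(y1, y2 <- y)
    ra_pair ((x · (p ∶ y2)) ⊗ (y1 · q)) b).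
  apply: eq_sw => a b; rewrite dot_pair_tens.
  rewrite -(sw_lin (L := ra_pair^~ b)); last by multilin.
  by apply: eq_sw => p q; rewrite -(sw_lin (L := ra_pair^~ b)); last by multilin.
rewrite sw_coassoc; [|by multilin..].
under eq_sw => a b do rewrite sw_exchange.
rewrite sw_exchange.
transitivity (\sw_(c, d <- y) \sw_(y1, y2 <- c) \sw_(z1, z2 <- z)
    ((x · (z1 ∶ d)) ◁ (z2 ∶ y2)) ⊗ y1).
  apply: eq_sw => c d; rewrite [RHS]sw_exchange.
  by apply: eq_sw => a b; rewrite ra_pair_dot.
rewrite sw_coassoc; [|by multilin..].
transitivity (\sw_(y1, y2 <- y) counit y2 *: (counit z *: (x ⊗ y1))).
  apply: eq_sw => y1 y2.
  rewrite -(sw_colon ops (E := fun u v => ((x · u) ◁ v) ⊗ y1)); last by multilin.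
  rewrite (conv_inverseE (L := fun u => u ⊗ y1) _ _ (dotK ops)); last by multilin.
  by rewrite (counit_colon ops) -scalerA.
by rewrite (sw_counitr y (E := fun u => counit z *: (x ⊗ u))) //; multilin.
Qed.

(** By [dot_surj] it suffices to evaluate where [ra_pair_dot] applies. *)
Lemma conv_inverse_dot_pair : conv_inverse dot_pair ra_pair.
Proof.
have bF := bilinear_ra_pair; have bP := bilinear_dot_pair.
move=> t z; move: t; apply: tensor_ext; [by multilin|by multilin|] => x y.
move: y z; apply: dot_surj; [by multilin|by multilin|] => y z.
transitivity (\sw_(a, b <- z) \sw_(y1, y2 <- y) 
   dot_pair ((x ◁ (a ∶ y2)) ⊗ y1) b).
  rewrite -sw_coassoc; [|by multilin..]; apply: eq_sw => a b.
  rewrite (sw_lin (L := dot_pair^~ b)); last by multilin.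
  by rewrite ra_pair_dot -(sw_lin (L := dot_pair^~ b)); last by multilin.
transitivity (\sw_(a, b <- z) \sw_(y1, y2 <- y) counit a *: (counit y2 *: (x ⊗ (y1 · b)))).
  transitivity (\sw_(a, b <- z) \sw_(z1, z2 <- b) \sw_(c, y2 <- y) \sw_(y1, d <- c) 
     ((x ◁ (a ∶ y2)) · (z1 ∶ d)) ⊗ (y1 · z2)).
    apply: eq_sw => a b; rewrite [RHS]sw_exchange; apply: eq_sw => c y2.
    by rewrite dot_pair_tens.
  rewrite -sw_coassoc; [|by multilin..]; apply: eq_sw => a b.
  under eq_sw => z1 z2 do [rewrite sw_coassoc; [|by multilin..]].
  rewrite sw_exchange; apply: eq_sw => y1 y2.
  rewrite sw_exchange.
  rewrite -(sw_colon ops (E := fun u v => ((x ◁ u) · v) ⊗ (y1 · b))); last by multilin.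
  rewrite (conv_inverseE (L := fun u => u ⊗ (y1 · b)) _ _ (raK ops)); last by multilin.
  by rewrite (counit_colon ops) mulrC -scalerA.
under eq_sw => a b do
  [rewrite (sw_lin (L := fun u => counit a *: u)); last by multilin].
rewrite (sw_counitl _ (E := fun b => \sw_(y1, y2 <- y) counit y2 *: (x ⊗ (y1 · b))));
  last by multilin.
rewrite (sw_counitr _ (E := fun b => x ⊗ (b · z))); last by multilin.
by rewrite (sw_counitr _ (E := fun b => x ⊗ (y · b))) //; multilin.
Qed.

Lemma ra_dot_mull :
  (forall x y z, (x * y) ◁ z =
     \sw_(y1, y2 <- y) \sw_(z1, z2 <- z) (x ◁ (y1 ▷ z1)) * (y2 ◁ z2)) <->
  (forall x y z, (x * y) · z =
     \sw_(z1, z2 <- z) \sw_(y1, y2 <- y) (x · (z1 ∶ y2)) * (y1 · z2)).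
Proof.
have lm := @mul_map_linear k H.
have bF := bilinear_ra_pair; have bP := bilinear_dot_pair.
have br : bilinear_fun (fun x y => x ◁ y) by multilin.
have bd : bilinear_fun (fun x y => x · y) by multilin.
have eF x y z : mul_map (ra_pair (x ⊗ y) z) =
    \sw_(y1, y2 <- y) \sw_(z1, z2 <- z) (x ◁ (y1 ▷ z1)) * (y2 ◁ z2).
  rewrite /ra_pair tlift_tens; last by multilin.
  rewrite -sw_lin //; apply: eq_sw => y1 y2; rewrite -sw_lin //.
  by apply: eq_sw => z1 z2; rewrite mul_map_tens.
have eP x y z : mul_map (dot_pair (x ⊗ y) z) =
    \sw_(z1, z2 <- z) \sw_(y1, y2 <- y) (x · (z1 ∶ y2)) * (y1 · z2).
  rewrite dot_pair_tens -sw_lin //; apply: eq_sw => y1 y2; rewrite -sw_lin //.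
  by apply: eq_sw => z1 z2; rewrite mul_map_tens.
split=> e x y z.
- rewrite -eP -mul_map_tens; symmetry.
  apply: (conv_inverse_intertwine (phi := linmap lm) bF bP br bd
    conv_inverse_ra_pair (raK ops)) => t c.
  move: t; apply: tensor_ext => [||u v]; [by multilin|by multilin|].
  by rewrite /= eF mul_map_tens e.
- rewrite -eF -mul_map_tens; symmetry.
  apply: (conv_inverse_intertwine (phi := linmap lm) bP bF bd br
    conv_inverse_dot_pair (dotK ops)) => t c.
  move: t; apply: tensor_ext => [||u v]; [by multilin|by multilin|].
  by rewrite /= eP mul_map_tens e.
Qed.

Lemma la_colon_1l : (forall y, 1 · y = counit y *: 1) ->
  (forall x, 1 ▷ x = x) <-> (forall x, x ∶ 1 = x).
Proof.
move=> e1; suff e x : x ∶ 1 = 1 ▷ x by split=> e' x; [rewrite e|rewrite -e].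
rewrite (colon_def ops); under eq_sw => a b do rewrite e1 tens_linearZl linearZ /=.
by rewrite sw_counitl //; multilin.
Qed.

Lemma la_colon_1r : (forall x, x · 1 = x) ->
  (forall x, x ▷ 1 = counit x *: 1) <-> (forall x, 1 ∶ x = counit x *: 1).
Proof.
move=> e1; suff e x : 1 ∶ x = x ▷ 1 by split=> e' x; [rewrite e|rewrite -e].
by rewrite (colon_def ops) sw_one ?e1 //; multilin.
Qed.

(** Composing (x * y) ▷ z and x ▷ (y ▷ z) with the colinear extension of [dot_pair],
    which is bijective, yields z ∶ (x * y) and (z ∶ y) ∶ x. *)
Lemma la_colon_mull :
  (forall x y z, (x * y) · z =
     \sw_(z1, z2 <- z) \sw_(y1, y2 <- y) (x · (z1 ∶ y2)) * (y1 · z2)) ->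
  (forall x y z, (x * y) ▷ z = x ▷ (y ▷ z)) <->
  (forall x y z, x ∶ (y * z) = (x ∶ z) ∶ y).
Proof.
move=> mul_dot.
have bF := bilinear_ra_pair; have bP := bilinear_dot_pair.
have lm := @mul_map_linear k H.
pose f (t : H ⊗ H) (z : H) : H := mul_map t ▷ z.
pose g (t : H ⊗ H) (z : H) : H := tlift (fun x y => x ▷ (y ▷ z)) t.
have bf : bilinear_fun f by rewrite /f; multilin.
have bg : bilinear_fun g by rewrite /g; multilin.
have fE x y z : f (x ⊗ y) z = (x * y) ▷ z by rewrite /f mul_map_tens.
have gE x y z : g (x ⊗ y) z = x ▷ (y ▷ z) by rewrite /g tlift_tens //; multilin.
have fP x y z : \sw_(z1, z2 <- z) f (dot_pair (x ⊗ y) z1) z2 = z ∶ (x * y).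
  rewrite (colon_def ops); apply: eq_sw => z1 z2.
  rewrite /f mul_dot dot_pair_tens; congr (la (_ ⊗ _)).
  rewrite -sw_lin //; apply: eq_sw => y1 y2; rewrite -sw_lin //.
  by apply: eq_sw => a b; rewrite mul_map_tens.
have gP x y z : \sw_(z1, z2 <- z) g (dot_pair (x ⊗ y) z1) z2 = (z ∶ y) ∶ x.
  transitivity (\sw_(a, b <- z) \sw_(p, q <- a) \sw_(y1, y2 <- y)
      (x · (p ∶ y2)) ▷ ((y1 · q) ▷ b)).
    apply: eq_sw => a b; rewrite dot_pair_tens -(sw_lin (L := g^~ b)); last by multilin.
    apply: eq_sw => p q; rewrite -(sw_lin (L := g^~ b)); last by multilin.
    by apply: eq_sw => y1 y2; rewrite gE.
  rewrite sw_coassoc; [|by multilin..].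
  rewrite (colon_def ops x) (sw_colon ops); last by multilin.
  rewrite [RHS]sw_exchange; apply: eq_sw => p b.
  rewrite sw_exchange; apply: eq_sw => y1 y2.
  rewrite (colon_def ops y1) -(sw_lin (L := fun u => _ ▷ u)) //; multilin.
split=> e x y z.
- by rewrite -fP -gP; apply: eq_sw => z1 z2; move: (dot_pair _ _);
    apply: tensor_ext => [||u v]; rewrite ?fE ?gE //; multilin.
- rewrite -fE -gE.
  rewrite -(conv_inverse_tail (x ⊗ y) z bP bF conv_inverse_dot_pair bf).
  rewrite -(conv_inverse_tail (x ⊗ y) z bP bF conv_inverse_dot_pair bg).
  apply: eq_sw => a b; move: (ra_pair _ _); apply: tensor_ext => [||u v].
  + by multilin.
  + by multilin.
  by rewrite fP gP e.
Qed.

(** The product formula for x ▷ (y * z), after the substitution that turns its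
    left-hand side into (x * y) ∶ a, becomes the product formula of a Hopf q-brace. *)
Lemma sol_mul_dot a x y :
  \sw_(x1, x2 <- x) \sw_(y1, y2 <- y)
    tlift (fun u v => u * (v ▷ y2)) (s (((a · y1) · x1) ⊗ x2)) =
  \sw_(a1, a2 <- a) \sw_(y1, y2 <- y) (x ∶ (a1 · y2)) * (y1 ∶ a2).
Proof.
rewrite sw_exchange.
transitivity (\sw_(b, c <- y) \sw_(a1, a2 <- a) \sw_(y1, y2 <- b)
   (x ∶ (a2 · y1)) * ((a1 · y2) ▷ c)).
  apply: eq_sw => b c; rewrite (sol_dot_tlift ops); last by multilin.
  by rewrite (sw_dot ops) //; multilin.
rewrite sw_exchange.
transitivity (\sw_(a1, a2 <- a) \sw_(y1, y2 <- y) (x ∶ (a2 · y1)) * (y2 ∶ a1)).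
  apply: eq_sw => a1 a2; rewrite sw_coassoc; [|by multilin..].
  apply: eq_sw => y1 y2; rewrite (colon_def ops a1 y2) -sw_lin //; multilin.
by rewrite -(dot_colon_swap ops (E := fun u v => (x ∶ v) * u)) //; multilin.
Qed.

(** The substitution of [sol_mul_dot] is invertible by two applications of
    [dot_surj], one for each factor. *)
Lemma la_colon_mulr :
  (forall x y z, x · (y * z) = (x · z) · y) ->
  (forall x y z, x ▷ (y * z) =
     \sw_(x1, x2 <- x) \sw_(y1, y2 <- y) (x1 ▷ y1) * ((x2 ◁ y2) ▷ z)) <->
  (forall x y z, (x * y) ∶ z =
     \sw_(z1, z2 <- z) \sw_(y1, y2 <- y) (x ∶ (z1 · y2)) * (y1 ∶ z2)).
Proof.
move=> dot_mulr.
have colonE a x y : (x * y) ∶ a = \sw_(x1, x2 <- x) \sw_(y1, y2 <- y)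
    ((a · y1) · x1) ▷ (x2 * y2).
  rewrite (colon_def ops) sw_mul; last by multilin.
  by apply: eq_sw => x1 x2; apply: eq_sw => y1 y2; rewrite dot_mulr.
have rE x y z : \sw_(x1, x2 <- x) \sw_(y1, y2 <- y) (x1 ▷ y1) * ((x2 ◁ y2) ▷ z) =
   tlift (fun u v => u * (v ▷ z)) (s (x ⊗ y)).
  by rewrite (sol_tlift ops) //; multilin.
split=> e x y z.
- rewrite colonE -sol_mul_dot; apply: eq_sw => x1 x2; apply: eq_sw => y1 y2.
  by rewrite e rE.
rewrite rE; move: x y; apply: dot_surj; [by multilin|by multilin|].
move=> a x; move: a z.
apply: dot_surj; [by multilin|by multilin|] => a y.
by rewrite sw_exchange -colonE e -sol_mul_dot sw_exchange.
Qed.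

(** The product formula gives x · z = Σ (x · z1) (1 · z2); taking 1 ◁ z1 for x and
    cancelling leaves 1 · z on the right. *)
Lemma counit_dot_1l :
  (forall x, x · 1 = x) -> (forall x, x ∶ 1 = x) ->
  (forall x y z, (x * y) · z =
     \sw_(z1, z2 <- z) \sw_(y1, y2 <- y) (x · (z1 ∶ y2)) * (y1 · z2)) ->
  forall y, 1 · y = counit y *: 1.
Proof.
move=> dot1 colon1 mul_dot y.
have br : bilinear_fun (fun x y => x ◁ y) by multilin.
have bd : bilinear_fun (fun x y => x · y) by multilin.
rewrite -(raK ops 1 y).
transitivity (\sw_(a, b <- y) \sw_(b1, b2 <- b) ((1 ◁ a) · b1) * (1 · b2)).
  rewrite (conv_inverse_tail (E := fun u v => u * (1 · v)) _ _ bd br (raK ops)).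
    by rewrite mul1r.
  by multilin.
apply: eq_sw => a b; rewrite -[in RHS](mulr1 (1 ◁ a)) mul_dot.
by apply: eq_sw => b1 b2; rewrite sw_one ?colon1 //; multilin.
Qed.

(** Put g y = 1 ∶ y, which equals y ▷ 1 and thus preserves coproducts.  The product
    formula says Σ g y1 * g y2 = g y, and the antipode composed with g is a
    left convolution inverse of g, so g is the unit of convolution. *)
Lemma counit_colon_1l :
  (forall x, x · 1 = x) ->
  (forall x y z, (x * y) ∶ z =
     \sw_(z1, z2 <- z) \sw_(y1, y2 <- y) (x ∶ (z1 · y2)) * (y1 ∶ z2)) ->
  forall y, 1 ∶ y = counit y *: 1.
Proof.
move=> dot1 mul_colon y; pose g x := 1 ∶ x.
have gE x : g x = x ▷ 1 by rewrite /g (colon_def ops) sw_one ?dot1 //; multilin.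
have lg : linear g by rewrite /g; multilin.
have swg (E : H -> H -> H) x : bilinear_fun E ->
    sweedler (g x) E = \sw_(x1, x2 <- x) E (g x1) (g x2).
  move=> bE; rewrite gE (sw_la ops) //; apply: eq_sw => x1 x2.
  by rewrite sw_one -?gE //; multilin.
have gg x : \sw_(x1, x2 <- x) g x1 * g x2 = g x.
  rewrite {3}/g -(mulr1 1) mul_colon; apply: eq_sw => x1 x2.
  by rewrite sw_one ?dot1 //; multilin.
have Sg x : \sw_(x1, x2 <- x) antipode H (g x1) * g x2 = counit x *: 1.
  rewrite -(swg (fun u v => antipode H u * v)); last by multilin.
  by rewrite antipodel /g (counit_colon ops) counit1 mulr1.
rewrite -/(g y) -[LHS](sw_counitl y (E := g)) //.
transitivity (\sw_(a, b <- y) \sw_(b1, b2 <- b) antipode H (g a) * (g b1 * g b2)).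
  under [RHS]eq_sw => a b do under eq_sw => b1 b2 do rewrite mulrA.
  rewrite -sw_coassoc; [|by multilin..].
  apply: eq_sw => a b; rewrite (sw_lin (L := fun u => u * g b)); last by multilin.
  by rewrite Sg -scalerAl mul1r.
rewrite -Sg; apply: eq_sw => a b.
by rewrite (sw_lin (L := fun u => antipode H (g a) * u)) ?gg //; multilin.
Qed.

End HopfBrace.

(** * Weak braiding operators by components *)

Section WeakBraiding.
Variables (k : fieldType) (H : hopfAlgType k).
Variables (s : {linear (H ⊗ H)%type -> (H ⊗ H)%type}).
Variables (la ra dot colon : {linear (H ⊗ H)%type -> H}).

Local Notation "x ▷ y" := (la (x ⊗ y)).
Local Notation "x ◁ y" := (ra (x ⊗ y)).
Local Notation "x · y" := (dot (x ⊗ y)).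
Local Notation "x ∶ y" := (colon (x ⊗ y)).

Hypothesis ops : nondegenerate_ops s la ra dot colon.

Lemma coalg_morphism_map12 : coalg_morphism (map12 s).
Proof. exact: coalg_morphism_tmap (sol_morph ops) (coalg_morphism_id H). Qed.

Lemma coalg_morphism_map23 : coalg_morphism (map23 s).
Proof.
exact: (coalg_morphism_comp (coalg_morphism_comp (coalg_morphism_tassocI H H H)
  (coalg_morphism_tmap (coalg_morphism_id H) (sol_morph ops)))
  (coalg_morphism_tassoc H H H)).
Qed.

Let lm := @mul_map_linear k H.
Let l12 := map12_linear s.
Let l23 := map23_linear s.

(** The right-hand side of the equivalence compares the first components of the
    two sides, then the second ones; the same holds in [braiding_mulr]. *)
Lemma braiding_mull :
  s \o tmap mul_map idfun =1 tmap idfun mul_map \o tassoc \o map12 s \o map23 s <->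
  (forall x y z, (x * y) ▷ z = x ▷ (y ▷ z)) /\
  (forall x y z, (x * y) ◁ z =
     \sw_(y1, y2 <- y) \sw_(z1, z2 <- z) (x ◁ (y1 ▷ z1)) * (y2 ◁ z2)).
Proof.
set f := s \o _; set g := _ \o map23 s.
have mM := coalg_morphism_mul H.
have fM : coalg_morphism f.
  apply: coalg_morphism_comp; first exact: sol_morph ops.
  exact: coalg_morphism_tmap mM (coalg_morphism_id H).
have gM : coalg_morphism g.
  exact: (coalg_morphism_comp (coalg_morphism_comp (coalg_morphism_comp
    (coalg_morphism_tmap (coalg_morphism_id H) mM)
    (coalg_morphism_tassoc H H H)) coalg_morphism_map12) coalg_morphism_map23).
have [lf _ _] := fM; have [lg _ _] := gM.
have f_tens x y z : f (x ⊗ y ⊗ z) = s ((x * y) ⊗ z).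
  by rewrite /f /= tmapE /= mul_map_tens.
have g_tens x y z : g (x ⊗ y ⊗ z) =
    tlift (fun u v => tlift (fun a b => a ⊗ (b * v)) (s (x ⊗ u))) (s (y ⊗ z)).
  rewrite /g /= map23_tens.
  rewrite (tlift_lin _ _ (f := map12 s)) // (tlift_lin _ _ (f := tassoc)); last by multilin.
  rewrite linear_tlift.
  apply: eq_tlift => u v; rewrite map12_tens.
  move: (s (x ⊗ u)); apply: tensor_ext; [by multilin|by multilin|] => a b.
  rewrite tlift_tens; last by multilin.
  by rewrite /= tassocE tmapE /= mul_map_tens.
have f1 x y z : tformr counit (f (x ⊗ y ⊗ z)) = (x * y) ▷ z.
  by rewrite f_tens (tformr_sol ops).
have f2 x y z : tforml counit (f (x ⊗ y ⊗ z)) = (x * y) ◁ z.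
  by rewrite f_tens (tforml_sol ops).
have g1 x y z : tformr counit (g (x ⊗ y ⊗ z)) = x ▷ (y ▷ z).
  rewrite g_tens linear_tlift -(tformr_sol ops y) [in RHS]/tformr
    !(linear_tlift, tlift_lin _ _ (tens_linearr x)).
  apply: eq_tlift => u v; rewrite linear_tlift !linearZ /= -(tformr_sol ops) [in RHS]/tformr.
  rewrite (tlift_lin _ _ (f := fun w => counit v *: w)); last by multilin.
  by apply: eq_tlift => a b; rewrite /= tformrE counitM mulrC scalerA.
have g2 x y z : tforml counit (g (x ⊗ y ⊗ z)) =
    \sw_(y1, y2 <- y) \sw_(z1, z2 <- z) (x ◁ (y1 ▷ z1)) * (y2 ◁ z2).
  rewrite g_tens linear_tlift -(sol_tlift ops (E := fun u v => (x ◁ u) * v)); last by multilin.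
  apply: eq_tlift => u v; rewrite linear_tlift /= -(tforml_sol ops) /tforml.
  rewrite (tlift_lin _ _ (f := fun w => w * v)); last by multilin.
  apply: eq_tlift => a b /=.
  by rewrite -/(tforml _ _) tformlE scalerAl.
split=> [e|[e1 e2]].
- by split=> x y z; rewrite -?f1 -?f2 e ?g1 ?g2.
apply: (coalg_morphism_tens_eq fM gM).
- by apply: tensor_ext3 => [||x y z]; rewrite ?/comp ?f1 ?g1 //; multilin.
- by apply: tensor_ext3 => [||x y z]; rewrite ?/comp ?f2 ?g2 //; multilin.
Qed.

Lemma braiding_mulr :
  s \o tmap idfun mul_map \o tassoc =1 tmap mul_map idfun \o map23 s \o map12 s <->
  (forall x y z, x ▷ (y * z) =
     \sw_(x1, x2 <- x) \sw_(y1, y2 <- y) (x1 ▷ y1) * ((x2 ◁ y2) ▷ z)) /\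
  (forall x y z, x ◁ (y * z) = (x ◁ y) ◁ z).
Proof.
set f := s \o _ \o _; set g := _ \o map12 s.
have mM := coalg_morphism_mul H.
have fM : coalg_morphism f.
  exact: (coalg_morphism_comp (coalg_morphism_comp (sol_morph ops)
    (coalg_morphism_tmap (coalg_morphism_id H) mM)) (coalg_morphism_tassoc H H H)).
have gM : coalg_morphism g.
  exact: (coalg_morphism_comp (coalg_morphism_comp
    (coalg_morphism_tmap mM (coalg_morphism_id H)) coalg_morphism_map23)
    coalg_morphism_map12).
have [lf _ _] := fM; have [lg _ _] := gM.
have f_tens x y z : f (x ⊗ y ⊗ z) = s (x ⊗ (y * z)).
  by rewrite /f /= tassocE tmapE /= mul_map_tens.
have g_tens x y z : g (x ⊗ y ⊗ z) =
    tlift (fun u v => tlift (fun a b => (u * a) ⊗ b) (s (v ⊗ z))) (s (x ⊗ y)).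
  rewrite /g /= map12_tens.
  move: (s (x ⊗ y)); apply: tensor_ext; [by multilin|by multilin|] => u v.
  rewrite map23_tens tlift_tens; last by multilin.
  rewrite linear_tlift; apply: eq_tlift => a b.
  by rewrite /= tmapE /= mul_map_tens.
have f1 x y z : tformr counit (f (x ⊗ y ⊗ z)) = x ▷ (y * z).
  by rewrite f_tens (tformr_sol ops).
have f2 x y z : tforml counit (f (x ⊗ y ⊗ z)) = x ◁ (y * z).
  by rewrite f_tens (tforml_sol ops).
have g1 x y z : tformr counit (g (x ⊗ y ⊗ z)) =
   \sw_(x1, x2 <- x) \sw_(y1, y2 <- y) (x1 ▷ y1) * ((x2 ◁ y2) ▷ z).
  rewrite g_tens linear_tlift -(sol_tlift ops (E := fun u v => u * (v ▷ z))); last by multilin.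
  apply: eq_tlift => u v; rewrite linear_tlift /= -(tformr_sol ops) /tformr.
  rewrite (tlift_lin _ _ (f := fun w => u * w)); last by multilin.
  apply: eq_tlift => a b /=.
  by rewrite -/(tformr _ _) tformrE scalerAr.
have g2 x y z : tforml counit (g (x ⊗ y ⊗ z)) = (x ◁ y) ◁ z.
  rewrite g_tens linear_tlift -(tforml_sol ops x) /tforml.
  rewrite (tlift_lin _ _ (f := fun w => w ◁ z)); last by multilin.
  apply: eq_tlift => u v; rewrite linear_tlift tens_linearZl linearZ /= -(tforml_sol ops) /tforml.
  rewrite linear_tlift; apply: eq_tlift => a b /=.
  by rewrite -/(tforml _ _) tformlE counitM scalerA.
split=> [e|[e1 e2]].
- by split=> x y z; rewrite -?f1 -?f2 e ?g1 ?g2.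
apply: (coalg_morphism_tens_eq fM gM).
- by apply: tensor_ext3 => [||x y z]; rewrite ?/comp ?f1 ?g1 //; multilin.
- by apply: tensor_ext3 => [||x y z]; rewrite ?/comp ?f2 ?g2 //; multilin.
Qed.

Lemma braiding_1l : (forall h, s (1 ⊗ h) = h ⊗ 1) <->
  (forall h, 1 ▷ h = h) /\ (forall h, 1 ◁ h = counit h *: 1).
Proof.
split=> [e|[e1 e2] h].
  by split=> h; rewrite -?(tformr_sol ops) -?(tforml_sol ops) e ?tformrE ?tformlE ?counit1 ?scale1r.
rewrite (sol_def ops) sw_one; last by multilin.
under eq_sw => h1 h2 do rewrite e1 e2 linearZ /=.
by rewrite (sw_counitr _ (E := fun u => u ⊗ 1)) //; multilin.
Qed.

Lemma braiding_1r : (forall h, s (h ⊗ 1) = 1 ⊗ h) <->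
  (forall h, h ▷ 1 = counit h *: 1) /\ (forall h, h ◁ 1 = h).
Proof.
split=> [e|[e1 e2] h].
  by split=> h; rewrite -?(tformr_sol ops) -?(tforml_sol ops) e ?tformrE ?tformlE ?counit1 ?scale1r.
rewrite (sol_def ops).
under eq_sw => h1 h2.
  rewrite sw_one; last by multilin.
  rewrite e1 e2 tens_linearZl; over.
by rewrite (sw_counitl _ (E := fun u => 1 ⊗ u)) //; multilin.
Qed.

End WeakBraiding.

(** * The three equivalent structures *)

Section Main.
Variables (k : fieldType) (H : hopfAlgType k).
Variable s : {linear (H ⊗ H)%type -> (H ⊗ H)%type}.
Hypothesis s_solution : set_theoretic_solution s.
Hypothesis s_nondeg : left_nondegenerate s.

Let s_morph : coalg_morphism s := proj1 s_solution.
Let braid : braid_equation s := proj2 s_solution.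
Let ops := solution_ops s_morph s_nondeg.

Lemma weak_braiding_matched_pair : weak_braiding_operator s <-> matched_pair (s_2 s) (s_1 s).
Proof.
split=> [[_ e1 e2 e3 e4]|[[_ c1 c2] [_ d1 d2] e1 e2 e3 e4 _]].
- have [d2 e2'] := (braiding_mull ops).1 e1.
  have [e1' c2] := (braiding_mulr ops).1 e2.
  have [d1 e3'] := (braiding_1l ops).1 e3.
  have [e4' c1] := (braiding_1r ops).1 e4.
  split=> //.
  + by split=> //; exact: coalg_morphism_ract.
  + by split=> //; exact: coalg_morphism_lact.
  + by move=> x y; rewrite -(sol_def ops) -(sol_swap ops).
- split=> //.
  + exact/(braiding_mull ops).
  + exact/(braiding_mulr ops).
  + exact/(braiding_1l ops).
  + exact/(braiding_1r ops).
Qed.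

Lemma q_cycle_solution : q_cycle_coalgebra (dot_op s) (colon_op s).
Proof.
split; [exact: q_magma ops|exact: left_regular_dot_op|..] => x y z.
- exact: (dot_dot ops braid).
- exact: (dot_colon ops braid).
- exact: (colon_colon ops braid).
Qed.

Lemma matched_pair_Hopf_q_brace :
  matched_pair (s_2 s) (s_1 s) <-> Hopf_q_brace (dot_op s) (colon_op s).
Proof.
split=> [[[_ c1 c2] [_ d1 d2] e1 e2 e3 e4 _]|].
- have dot1 := (ra_dot_1r ops).1 c1.
  have dotM := (ra_dot_mulr ops).1 c2.
  have mul_dot := (ra_dot_mull ops).1 e2.
  have one_dot := (ra_dot_1l ops).1 e3.
  split.
  + exact: q_cycle_solution.
  + by split=> //; exact: (linearP (sol_dot_op s_nondeg)).
  + split; first exact: colon_op_linear.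
    * exact/(la_colon_1l ops one_dot).
    * exact/(la_colon_mull ops mul_dot).
  + exact: mul_dot.
  + exact/(la_colon_mulr ops dotM).
case=> _ [_ dot1 dotM] [_ colon1 colonM] mul_dot mul_colon.
have one_dot := counit_dot_1l ops dot1 colon1 mul_dot.
have one_colon := counit_colon_1l ops dot1 mul_colon.
split.
- split; first exact: coalg_morphism_ract.
  + exact/(ra_dot_1r ops).
  + exact/(ra_dot_mulr ops).
- split; first exact: coalg_morphism_lact.
  + exact/(la_colon_1l ops one_dot).
  + exact/(la_colon_mull ops mul_dot).
- exact/(la_colon_mulr ops dotM).
- exact/(ra_dot_mull ops).
- exact/(ra_dot_1l ops).
- exact/(la_colon_1r ops dot1).
- by move=> x y; rewrite -(sol_def ops) -(sol_swap ops).
Qed.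

End Main.

Theorem theorem5p18 (k : fieldType) (H : hopfAlgType k)
    (s : H ⊗ H -> H ⊗ H) :
  set_theoretic_solution s -> left_nondegenerate s ->
  [<-> weak_braiding_operator s;
       matched_pair (s_2 s) (s_1 s);
       Hopf_q_brace (dot_op s) (colon_op s)].
Proof.
move=> sol nd; have [[ls _ _] _] := sol.
have e12 := weak_braiding_matched_pair (s := linmap ls) sol nd.
have e23 := matched_pair_Hopf_q_brace (s := linmap ls) sol nd.
tfae.
- by move/e12.
- by move/e23.
- by move=> /e23 /e12.
Qed.
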